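(* Let $\delta>0$ and let $h,h^\delta\in L^2(\Omega)$, $f,f^\delta\in L^\infty(0,\tau;L^2(\Omega))$ satisfy $\|h-h^\delta\|^2+\theta\|f-f^\delta\|^2_{L^\infty(0,\tau;L^2(\Omega))}\le\delta^2$. Let $g\in L^2(\Omega)$ be the solution of $Tg=\Upsilon_{h,f}$ and suppose $g\in S_{\varrho,p}$ for some $\varrho,p>0$. Let $$N_\delta=\left[\left[\left(\frac{1}{C_{18}e_1^{p}e_2^2}\,\frac{\varrho}{\delta}\right)^{d/(2p+4)}\right]\right],$$ where $[[r]]$ is the greatest integer not exceeding $r$, and assume $N_\delta\ge1$. Then there is a constant $C_{19}>0$, depending only on $\alpha,\tau,\lambda_1,C_1,e_1,e_2$, such that $$\|g-g^{\delta,N_\delta}\|\le C_{19}\,\varrho^{2/(p+2)}\delta^{p/(p+2)}.$$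
   Context: Setting: $d\in\{1,\dots,7\}$, $\Omega\subset\mathbb R^d$ is a bounded domain with sufficiently smooth boundary, $\tau>0$, $\alpha\in(0,1)$; $\|\cdot\|$ and $\langle\cdot,\cdot\rangle$ are the norm and inner product of $L^2(\Omega)$. $0<\lambda_1<\lambda_2\le\cdots\to\infty$ are the Dirichlet eigenvalues of $-\Delta$ on $\Omega$ with eigenfunctions $\varphi_n\in H_0^1(\Omega)\cap H^2(\Omega)$ forming an orthonormal basis of $L^2(\Omega)$; $e_1,e_2>0$ are constants with $e_1n^{2/d}\le\lambda_n\le e_2n^{2/d}$ for all $n\in\mathbb N$ (known to exist). $w_n=\langle w,\varphi_n\rangle$ for $w\in L^2(\Omega)$, and $z_n(s)=\langle z(s),\varphi_n\rangle$ for $z\in L^\infty(0,\tau;L^2(\Omega))$. $\theta=\sum_{n=1}^\infty\lambda_n^{-4}<\infty$. Mittag-Leffler function: $E_{\gamma,b}(z)=\sum_{k=0}^\infty z^k/\Gamma(k\gamma+b)$. $C_1>0$ is a fixed constant with $\frac{C_1}{\Gamma(1-\alpha)}\frac1{1-x}\le E_{\alpha,1}(x)$ for all $x\le0$ (known to exist). For $h\in L^2(\Omega)$, $f\in L^\infty(0,\tau;L^2(\Omega))$: $\Psi_f^{\alpha,n}(t)=\int_0^t(t-s)^{\alpha-1}E_{\alpha,\alpha}(-\lambda_n^2(t-s)^\alpha)f_n(s)\,ds$, $\Upsilon_{h,f}^{\alpha,n}=h_n-\Psi_f^{\alpha,n}(\tau)$, $\Upsilon_{h,f}=\sum_n\Upsilon_{h,f}^{\alpha,n}\varphi_n\in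 L^2(\Omega)$ (and similarly for $h^\delta,f^\delta$). The operator $T:L^2(\Omega)\to L^2(\Omega)$ is $T\phi=\sum_nE_{\alpha,1}(-\lambda_n^2\tau^\alpha)\langle\phi,\varphi_n\rangle\varphi_n$. Source set: $S_{\varrho,p}=\{\phi\in L^2(\Omega):\|\phi\|_{H_p}\le\varrho\}$, $\|\phi\|_{H_p}^2=\sum_n\lambda_n^{2p}|\langle\phi,\varphi_n\rangle|^2$. Fourier truncation regularized solution: $g^{\delta,N}=\sum_{n=1}^N\frac{\Upsilon_{h^\delta,f^\delta}^{\alpha,n}}{E_{\alpha,1}(-\lambda_n^2\tau^\alpha)}\varphi_n$ for $N\in\mathbb N=\{1,2,\dots\}$. Constant: $C_{18}=\sqrt2\,\frac{\Gamma(1-\alpha)(1+\tau^\alpha\lambda_1^2)}{C_1\lambda_1^2}$. *)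

(* Defs.v *)
From HB Require Import structures.
From mathcomp Require Import all_boot all_order all_algebra.
From mathcomp Require Import all_classical all_reals all_analysis.
Import Order.TTheory GRing.Theory Num.Theory.
Import numFieldNormedType.Exports.

Set Implicit Arguments.
Unset Strict Implicit.
Unset Printing Implicit Defensive.

Local Open Scope classical_set_scope.
Local Open Scope ring_scope.

(* R^n, with the norm topology of 'rV[R]_n and with the sigma-algebra generated
   by the coordinate maps, that is, the Borel sigma-algebra. *)
Definition euclid (R : realType) (n : nat) : Type := 'rV[R]_n.

HB.instance Definition _ (R : realType) (n : nat) :=
  NormedModule.copy (euclid R n) 'rV[R]_n.

Definition coord (R : realType) (n : nat) (i : 'I_n) (x : euclid R n) :
  measurableTypeR R := x ord0 i.

Definition euclid_display : measure_display.
Proof. exact: default_measure_display. Qed.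

Section euclid_measurable.
Variables (R : realType) (n : nat).

Let m0 : g_sigma_preimage (@coord R n) set0.
Proof. exact: sigma_algebra0. Qed.

Let mC A :
  g_sigma_preimage (@coord R n) A -> g_sigma_preimage (@coord R n) (~` A).
Proof. exact: sigma_algebraC. Qed.

Let mU (F : (set (euclid R n))^nat) :
  (forall i, g_sigma_preimage (@coord R n) (F i)) ->
  g_sigma_preimage (@coord R n) (\bigcup_i (F i)).
Proof. exact: sigma_algebra_bigcup. Qed.

HB.instance Definition _ := @isMeasurable.Build euclid_display
  (euclid R n) (g_sigma_preimage (@coord R n)) m0 mC mU.

End euclid_measurable.

Lemma measurable_coord (R : realType) (n : nat) (i : 'I_n) :
  measurable_fun setT (@coord R n i).
Proof.
move=> _ Y mY; rewrite setTI; apply: sub_sigma_algebra => /=.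
rewrite -bigcup_seq/=; exists i => /=; first by rewrite mem_index_enum.
by exists Y => //; rewrite setTI.
Qed.

Lemma measurable_fun_coordP (R : realType) (n : nat) d (T : measurableType d)
    (f : T -> euclid R n) :
  (forall i, measurable_fun setT (@coord R n i \o f)) -> measurable_fun setT f.
Proof.
move=> mf.
suff H : g_sigma_preimage (fun i => @coord R n i \o f) `<=` measurable.
  move=> _ A mA; apply: H; rewrite g_sigma_preimage_comp.
  by exists A.
apply: smallest_sub; first exact: sigma_algebra_measurable.
rewrite -bigcup_seq; apply: bigcup_sub => i _.
by move=> A [B mB <-]; exact: mf.
Qed.

Definition euclid_cons (R : realType) (n : nat)
    (z : measurableTypeR R * euclid R n) : euclid R n.+1 :=
  \row_(i < n.+1) if unlift ord0 i is Some j then z.2 ord0 j else z.1.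

Lemma measurable_euclid_cons (R : realType) (n : nat) :
  measurable_fun setT (@euclid_cons R n).
Proof.
apply: measurable_fun_coordP => i.
case: (unliftP ord0 i) => [j ->|->].
- rewrite (_ : _ \o _ = @coord R n j \o snd); last first.
    by apply/funext => z /=; rewrite /coord mxE liftK.
  by apply: measurableT_comp; [exact: measurable_coord|].
- rewrite (_ : _ \o _ = fst)//.
  by apply/funext => z /=; rewrite /coord mxE unlift_none.
Qed.

Section lebesgue_step.
Local Open Scope ereal_scope.
Variables (R : realType) (n : nat).
Variable m : {sigma_finite_measure set (euclid R n) -> \bar R}.

Definition lebesgue_step : set (euclid R n.+1) -> \bar R :=
  pushforward (lebesgue_measure \x m) (@euclid_cons R n).

Let push : {measure set (euclid R n.+1) -> \bar R} :=
  measure_function_pushforward__canonical__measure_function_Measure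
    (lebesgue_measure \x m) (@measurable_euclid_cons R n).

HB.instance Definition _ := isMeasure.Build _ _ _ lebesgue_step
  (measure0 push) (measure_ge0 push) (@measure_semi_sigma_additive _ _ _ push).

Let lebesgue_step_sigma_finite : sigma_finite setT lebesgue_step.
Proof.
have /sigma_finiteP[F [TF ndF Foo]] :=
  sigma_finiteT (@lebesgue_measure R : {sigma_finite_measure set _ -> \bar R}).
have /sigma_finiteP[G [TG ndG Goo]] := sigma_finiteT m.
pose u (x : euclid R n.+1) : measurableTypeR R * euclid R n :=
  (x ord0 ord0, \row_(i < n) x ord0 (lift ord0 i))%R.
have mu : measurable_fun setT u.
  apply/measurable_fun_pairP; split; first exact: measurable_coord.
  apply: measurable_fun_coordP => i.
  rewrite (_ : _ \o _ = @coord R n.+1 (lift ord0 i)).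
    exact: measurable_coord.
  by apply/funext => x /=; rewrite /coord mxE.
have uK z : u (euclid_cons z) = z.
  case: z => a b; rewrite /u mxE unlift_none/=; congr pair.
  by apply/rowP => i; rewrite !mxE liftK.
exists (fun k => u @^-1` (F k `*` G k)).
  rewrite -preimage_bigcup (_ : \bigcup_k _ = setT) ?preimage_setT//.
  rewrite -setXTT TF TG predeqE => -[x y]; split.
    by move=> [k _ []/= ? ?]; split; exists k.
  move=> [/= [k _ Fkx] [l _ Gly]]; exists (maxn k l) => //; split.
  - by move: x Fkx; exact/subsetPset/ndF/leq_maxl.
  - by move: y Gly; exact/subsetPset/ndG/leq_maxr.
move=> k; have [? ?] := Foo k; have [? ?] := Goo k.
have mX : measurable (F k `*` G k) by exact: measurableX.
split; first by rewrite -[X in measurable X]setTI; exact: mu.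
rewrite /lebesgue_step /pushforward -comp_preimage.
rewrite (_ : u \o _ = id); last exact/funext.
rewrite preimage_id product_measure1E//.
by rewrite lte_mul_pinfty// ge0_fin_numE.
Qed.

HB.instance Definition _ := Measure_isSigmaFinite.Build _ _ _ lebesgue_step
  lebesgue_step_sigma_finite.

End lebesgue_step.

(* n-dimensional Lebesgue measure: the n-fold product of lebesgue_measure. *)
Fixpoint lebesgue_nd (R : realType) (n : nat) :
    {sigma_finite_measure set (euclid R n) -> \bar R} :=
  if n is k.+1 then lebesgue_step (lebesgue_nd R k)
  else \d_(0 : euclid R 0).

Lemma lebesgue_nd_box (R : realType) (n : nat)
    (A : 'I_n -> set (measurableTypeR R)) :
  (forall i, measurable (A i)) ->
  lebesgue_nd R n [set x | forall i, A i (x ord0 i)] =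
  (\prod_(i < n) lebesgue_measure (A i))%E.
Proof.
elim: n A => [|n IH] A mA.
  rewrite big_ord0 /= diracE mem_set// => -[].
  by [].
pose B := [set x : euclid R n | forall i, A (lift ord0 i) (x ord0 i)].
rewrite big_ord_recl -(IH (fun i => A (lift ord0 i)))// -/B.
have mB : measurable B.
  rewrite (_ : B = \bigcap_(i in setT)
    (@coord R n i @^-1` A (lift ord0 i))); last first.
    by apply/seteqP; split => x /= H i; [move=> _|]; exact: H.
  apply: fin_bigcap_measurable => [|i _]; first exact: finite_finset.
  by rewrite -[X in measurable X]setTI; exact: measurable_coord.
rewrite -product_measure1E//= /lebesgue_step /pushforward.
congr (_ _); apply/seteqP; split => -[a x] /=.
  move=> H; split; first by have := H ord0; rewrite mxE unlift_none.
  by move=> i; have := H (lift ord0 i); rewrite mxE liftK.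
move=> [Aa Ax] i; rewrite mxE.
by case: (unliftP ord0 i) => [j ->|->]//=; exact: Ax.
Qed.

Section sobolev.
Variables (R : realType) (d : nat).
Implicit Types (Om : set (euclid R d)) (u v w psi : euclid R d -> R).

Definition partial (i : 'I_d) u : euclid R d -> R :=
  fun x => 'D_(delta_mx ord0 i) u x.

Definition partials (s : seq 'I_d) u := foldr partial u s.

(* C^k functions on R^d: all iterated partial derivatives up to order k exist
   and are continuous. *)
Definition Ck (k : nat) u : Prop := forall s : seq 'I_d, (size s <= k)%N ->
  continuous (partials s u) /\
  ((size s < k)%N -> forall (i : 'I_d) (x : euclid R d),
     derivable (partials s u) x (delta_mx ord0 i)).

Definition test_function Om psi : Prop := (forall k, Ck k psi) /\
  exists K : set (euclid R d),
    [/\ compact K, K `<=` Om & forall x, ~ K x -> psi x = 0].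

(* Elements of L^2(Om) are represented by real functions on R^d, of which only
   the values on Om matter (u \_ Om is u extended by 0 outside of Om). *)
Definition L2 Om u : Prop := u \_ Om \in Lfun (lebesgue_nd R d) 2%:E.

Definition L2norm Om u : \bar R :=
  'N[lebesgue_nd R d]_(2%:E)[EFin \o (u \_ Om)]%E.

Definition L2dot Om u v : R := \int[lebesgue_nd R d]_(x in Om) (u x * v x).

Definition weak_partial Om (i : 'I_d) u v : Prop := [/\ L2 Om u, L2 Om v &
  forall psi, test_function Om psi ->
    \int[lebesgue_nd R d]_(x in Om) (u x * partial i psi x) =
    - \int[lebesgue_nd R d]_(x in Om) (v x * psi x)].

(* H^1_0(Om) is the closure of the test functions for the H^1 norm. *)
Definition H10 Om u : Prop := L2 Om u /\
  exists psi : nat -> euclid R d -> R,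
    [/\ forall k, test_function Om (psi k),
        L2norm Om (psi k \- u) @[k --> \oo] --> 0%E &
        forall i, exists v, weak_partial Om i u v /\
          L2norm Om (partial i (psi k) \- v) @[k --> \oo] --> 0%E].

Definition H2 Om u : Prop := L2 Om u /\
  forall i, exists v, weak_partial Om i u v /\
    forall j, exists w, weak_partial Om j v w.

(* u is a (weak) solution of - Laplacian u = mu u, u in H^1_0 and H^2. *)
Definition dirichlet_eigenfunction Om (mu : R) u : Prop :=
  [/\ H10 Om u, H2 Om u &
    exists v w : 'I_d -> euclid R d -> R,
      [/\ forall i, weak_partial Om i u (v i),
          forall i, weak_partial Om i (v i) (w i) &
          {ae lebesgue_nd R d, forall x, Om x ->
             - (\sum_(i < d) w i x) = mu * u x}]].

(* Near each boundary point, Om is a strict sublevel set of a C^2 function with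
   nonzero gradient at that point. *)
Definition C2_boundary Om : Prop :=
  forall x0 : euclid R d, (closure Om `\` interior Om) x0 ->
    exists rho : euclid R d -> R,
      [/\ Ck 2 rho, exists i, partial i rho x0 != 0 &
          \forall x \near x0, Om x <-> rho x < 0].

Definition bounded_smooth_domain Om : Prop :=
  [/\ open Om, connected Om, Om !=set0, bounded_set Om & C2_boundary Om].

(* Sequences are indexed by 1, 2, 3, ...; their values at 0 are irrelevant. *)
Definition lincomb (phi : nat -> euclid R d -> R) (c : nat -> R) (N : nat) :
  euclid R d -> R := fun x => \sum_(1 <= n < N.+1) c n * phi n x.

Definition L2sum Om (phi : nat -> euclid R d -> R) (c : nat -> R) v : Prop :=
  L2 Om v /\ L2norm Om (v \- lincomb phi c N) @[N --> \oo] --> 0%E.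

Definition orthonormal_basis Om (phi : nat -> euclid R d -> R) : Prop :=
  [/\ forall n, (1 <= n)%N -> L2 Om (phi n),
      forall m n, (1 <= m)%N -> (1 <= n)%N ->
        L2dot Om (phi m) (phi n) = (m == n)%:R &
      forall v, L2 Om v -> L2sum Om phi (fun n => L2dot Om v (phi n)) v].

Definition dirichlet_spectrum Om (lam : nat -> R)
    (phi : nat -> euclid R d -> R) : Prop :=
  [/\ [/\ 0 < lam 1, lam 1 < lam 2,
          forall n, (1 <= n)%N -> lam n <= lam n.+1 &
          lam n @[n --> \oo] --> +oo],
      forall n, (1 <= n)%N -> dirichlet_eigenfunction Om (lam n) (phi n) &
      orthonormal_basis Om phi].

(* Functions of time are given on the whole line, but only their values on the
   open interval (0, tau) matter. *)
Definition simple_L2 Om (z : R -> euclid R d -> R) : Prop :=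
  exists (m : nat) (A : 'I_m -> set (measurableTypeR R))
    (w : 'I_m -> euclid R d -> R),
    [/\ forall i, measurable (A i), forall i, L2 Om (w i) &
        forall s x, z s x = \sum_(i < m) \1_(A i) s * w i x].

(* Bochner measurability of a representative: z is the pointwise limit on
   (0, tau) of simple functions. A function that is only an almost everywhere
   limit of simple functions coincides almost everywhere with such a z. *)
Definition strongly_measurable Om (tau : R) (z : R -> euclid R d -> R) : Prop :=
  exists zk : nat -> R -> euclid R d -> R,
    (forall k, simple_L2 Om (zk k)) /\
    forall s, `]0, tau[%classic s ->
      L2norm Om (zk k s \- z s) @[k --> \oo] --> 0%E.

Definition LinfL2norm Om (tau : R) (z : R -> euclid R d -> R) : \bar R :=
  'N[@lebesgue_measure R]_(+oo)
    [(fun s => L2norm Om (z s)) \_ `]0%R, tau[%classic]%E.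

Definition LinfL2 Om (tau : R) (z : R -> euclid R d -> R) : Prop :=
  [/\ forall s, `]0, tau[%classic s -> L2 Om (z s),
      strongly_measurable Om tau z &
      (LinfL2norm Om tau z < +oo)%E].

End sobolev.

Section mittag_leffler.
Variable R : realType.

(* Meaningful for x > 0, the only case used below. *)
Definition Gamma (x : R) : R :=
  \int[@lebesgue_measure R]_(t in `]0, +oo[%classic) (t `^ (x - 1) * expR (- t)).

Definition mittag_leffler (gam b z : R) : R :=
  limn (series (fun k : nat => z ^+ k / Gamma (k%:R * gam + b))).

Definition C18 (alpha tau lam1 C1 : R) : R :=
  Num.sqrt 2 * (Gamma (1 - alpha) * (1 + tau `^ alpha * lam1 ^+ 2) /
                (C1 * lam1 ^+ 2)).

End mittag_leffler.

Section regularization.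
Variables (R : realType) (d : nat) (Om : set (euclid R d)).
Variables (lam : nat -> R) (phi : nat -> euclid R d -> R).
Variables (alpha tau : R).
Implicit Types (g h v : euclid R d -> R) (f : R -> euclid R d -> R).

Definition Psi f (n : nat) (t : R) : R :=
  \int[@lebesgue_measure R]_(s in `]0, t[%classic)
    ((t - s) `^ (alpha - 1) *
     mittag_leffler alpha alpha (- lam n ^+ 2 * (t - s) `^ alpha) *
     L2dot Om (f s) (phi n)).

Definition Upsilon_coef h f (n : nat) : R := L2dot Om h (phi n) - Psi f n tau.

(* v = Upsilon_{h,f} *)
Definition is_Upsilon h f v : Prop := L2sum Om phi (Upsilon_coef h f) v.

Definition T_symbol (n : nat) : R :=
  mittag_leffler alpha 1 (- lam n ^+ 2 * tau `^ alpha).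

(* v = T g *)
Definition is_T g v : Prop :=
  L2sum Om phi (fun n => T_symbol n * L2dot Om g (phi n)) v.

Definition Hp_norm (p : R) g : \bar R :=
  ((\sum_(1 <= n <oo) (lam n `^ (2 * p) * `|L2dot Om g (phi n)| ^+ 2)%:E)
     `^ 2^-1)%E.

Definition source_set (rho p : R) g : Prop :=
  L2 Om g /\ (Hp_norm p g <= rho%:E)%E.

Definition theta : \bar R := (\sum_(1 <= n <oo) (lam n ^- 4)%:E)%E.

Definition truncated_solution h f (N : nat) : euclid R d -> R :=
  lincomb phi (fun n => Upsilon_coef h f n / T_symbol n) N.

End regularization.

Definition N_delta (R : realType) (d : nat) (e1 e2 c18 p rho delta : R) : nat :=
  Num.truncn ((1 / (c18 * e1 `^ p * e2 ^+ 2) * (rho / delta))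
                `^ (d%:R / (2 * p + 4))).

(* Main.v *)
(** The coefficients satisfy [T_n g_n = Upsilon_n], so the error
    [g - g^(delta,N)] has the coefficients [(Upsilon_n - Upsilon_n^delta) / T_n]
    for [n <= N] and [g_n] for [n > N].  The source condition bounds the tail by
    [lambda_(N+1)^(-p) rho], the lower bound on [E_(alpha,1)] gives
    [1 / T_n <= const lambda_n^2], and the choice of [N] balances both parts.

    It remains to bound [Upsilon - Upsilon^delta] in [l^2] by a multiple of
    [delta]. By duality in [n], the contribution of [f - f^delta] is at most
    [sup_(x >= 0) |E_(alpha,alpha)(-x)| tau^alpha / alpha] times the norm of
    [f - f^delta], which is at most [lambda_1^2 delta] since
    [theta >= lambda_1^(-4)]. So only the boundedness of [E_(alpha,alpha)] on the
    negative axis is needed. It comes from a discrete model: with [A_n] the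
    coefficients of [(1 - z)^(-alpha)], the solution [r] of [r + mu A * r = A]
    satisfies [0 <= r <= A] because the ratios [A_(n+1) / A_n] increase (Kaluza).
    Expanding [r] in powers of [mu], the remainder after [K] terms has the sign of
    [(-mu)^K], so the truncations at odd (even) [K] are [>= 0] ([<= A_n]). With
    [mu = x n^(-alpha)] and after multiplication by [n^(1-alpha)], Gauss' limit
    formula turns these truncations into the partial sums of
    [E_(alpha,alpha)(-x)], whence [0 <= E_(alpha,alpha)(-x) <= 1 / Gamma(alpha)]. *)

Require Import Defs.
From mathcomp Require Import all_boot all_order all_algebra.
From mathcomp Require Import all_classical all_reals all_analysis.
From mathcomp Require Import measurable_realfun ess_sup_inf ring lra.
Import Order.TTheory GRing.Theory Num.Theory.
Import numFieldNormedType.Exports.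
Local Open Scope classical_set_scope.
Local Open Scope ring_scope.
Set Implicit Arguments.
Unset Strict Implicit.
Unset Printing Implicit Defensive.

(** * The Gamma function *)

Section gamma.
Context {R : realType}.
Notation mu := (@lebesgue_measure R).

Definition gamma_density (x t : R) : R := t `^ (x - 1) * expR (- t).

(** Compact intervals away from 0 and infinity, where integration by parts applies. The shift by 2
    makes the endpoints distinct already for [n = 0]. *)
Definition exhaust (n : nat) : set R := `[n.+2%:R^-1, n.+2%:R]%classic.

Lemma exhaust_gt0 n t : exhaust n t -> 0 < t.
Proof.
rewrite /exhaust/= in_itv/= => /andP[h _]; apply: lt_le_trans h.
by rewrite invr_gt0.
Qed.

Lemma exhaust_nondecreasing : nondecreasing_seq exhaust.
Proof.
move=> m n mn; rewrite subsetEset => t; rewrite /exhaust/= !in_itv/=.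
move=> /andP[h1 h2]; apply/andP; split.
  by apply: le_trans h1; rewrite lef_pV2 ?posrE// ler_nat !ltnS.
by apply: le_trans h2 _; rewrite ler_nat !ltnS.
Qed.

Lemma bigcup_exhaust : \bigcup_n exhaust n = `]0, +oo[%classic.
Proof.
apply/seteqP; split => t.
  by move=> [n _ /exhaust_gt0]; rewrite /= in_itv/= andbT.
rewrite /= in_itv/= andbT => t0.
exists (maxn (Num.truncn t) (Num.truncn t^-1)) => //.
rewrite /exhaust/= in_itv/=; apply/andP; split; last first.
  apply: (le_trans (ltW (truncnS_gt t))); rewrite ler_nat ltnS.
  by apply: leq_trans (leq_maxl _ _) _.
rewrite -[leRHS]invrK lef_pV2 ?posrE ?invr_gt0//.
apply: (le_trans (ltW (truncnS_gt t^-1))); rewrite ler_nat ltnS.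
by apply: leq_trans (leq_maxr _ _) _.
Qed.

Lemma gamma_density_ge0 (x t : R) : 0 <= gamma_density x t.
Proof. by rewrite mulr_ge0 ?powR_ge0 ?expR_ge0. Qed.

Lemma measurable_gamma_density (x : R) : measurable_fun setT (gamma_density x).
Proof.
apply: measurable_funM; first exact: measurable_powR.
by apply: measurableT_comp => //.
Qed.

(* [Gamma] as an extended real: the functional equation holds before
   integrability is known, and yields it. *)
Definition gammae (x : R) : \bar R :=
  (\int[mu]_(t in `]0%R, +oo[%classic) (gamma_density x t)%:E)%E.

Lemma cvg_exhaust (f : R -> R) : measurable_fun setT f -> (forall t, 0 <= f t) ->
  (\int[mu]_(t in exhaust n) (f t)%:E)%E @[n --> \oo] -->
  (\int[mu]_(t in `]0%R, +oo[%classic) (f t)%:E)%E.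
Proof.
move=> mf f0; rewrite -bigcup_exhaust.
apply: ge0_nondecreasing_set_cvg_integral.
- exact: exhaust_nondecreasing.
- by move=> i; exact: measurable_itv.
- by move=> i; apply/measurable_EFinP; exact: measurable_funTS.
- by move=> i t _; rewrite lee_fin.
Qed.

Lemma is_derive_Nexp (t : R) : is_derive t 1 (fun s => - expR (- s)) (expR (- t)).
Proof.
have H1 : is_derive t 1 (fun s : R => - s) (- 1).
  exact: is_deriveN.
have := is_deriveN (@is_derive1_comp _ expR (fun s => - s) t _ _ (is_derive_expR (- t)) H1).
by rewrite mulrN1 opprK.
Qed.

Lemma within_derive (f df : R -> R) (a b : R) :
  (forall t, a <= t <= b -> is_derive t 1 f (df t)) ->
  {within `[a, b], continuous f}.
Proof.
move=> H; apply: derivable_within_continuous => t; rewrite in_itv/= => tab.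
by have [] := H _ tab.
Qed.

Lemma LRcontinuous_derive (f df : R -> R) (a b : R) : a < b ->
  (forall t, a <= t <= b -> is_derive t 1 f (df t)) ->
  derivable_oo_LRcontinuous f a b.
Proof.
move=> ab H; split.
- by move=> t; rewrite in_itv/= => /andP[? ?]; have [|//] := H t; rewrite !ltW.
- have [Ha _] : is_derive a 1 f (df a) by apply: H; rewrite lexx ltW.
  apply: cvg_at_right_filter.
  exact/differentiable_continuous/derivable1_diffP.
- have [Ha _] : is_derive b 1 f (df b) by apply: H; rewrite lexx ltW.
  apply: cvg_at_left_filter.
  exact/differentiable_continuous/derivable1_diffP.
Qed.

(** Integration by parts of [t ^ x] against the primitive [- expR (- t)] of [expR (- t)]; the
    boundary terms are kept and shown to vanish later. *)
Lemma gamma_exhaust_recursion (x : R) n : 0 < x ->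
  (\int[mu]_(t in exhaust n) (gamma_density (x + 1) t)%:E =
   (n.+2%:R^-1 `^ x * expR (- n.+2%:R^-1) - n.+2%:R `^ x * expR (- n.+2%:R))%:E
   + x%:E * \int[mu]_(t in exhaust n) (gamma_density x t)%:E)%E.
Proof.
move=> x0; set a : R := n.+2%:R^-1; set b : R := n.+2%:R.
have a0 : 0 < a by rewrite invr_gt0.
have ab : a < b.
  apply: (@lt_trans _ _ 1); rewrite /a /b ?ltr1n//.
  by rewrite invf_lt1// ltr1n.
have dP y t : a <= t <= b -> is_derive t 1 (@powR R ^~ y) (y * t `^ (y - 1)).
  by move=> /andP[h _]; apply: is_derive1_powR; apply: lt_le_trans h.
have dE t : a <= t <= b -> is_derive t 1 (fun s => - expR (- s)) (expR (- t)).
  by move=> _; exact: is_derive_Nexp.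
have cE : {within `[a, b], continuous (fun s : R => expR (- s))}.
  apply: continuous_subspaceT => t.
  by apply: continuous_comp; [exact: continuousN|exact: continuous_expR].
have cP y : {within `[a, b], continuous (fun s : R => s `^ y)}.
  exact: within_derive (dP y).
have := @integration_by_parts R (@powR R ^~ x) (fun s => - expR (- s))
  (fun t => x * t `^ (x - 1)) (fun t => expR (- t)) a b ab.
rewrite -/(exhaust n).
have cxP : {within `[a, b], continuous (fun t : R => x * t `^ (x - 1))}.
  apply: (within_derive (df := fun t => x * ((x - 1) * t `^ (x - 1 - 1)))) => t tab.
  exact: (is_deriveZ x (dP (x - 1) t tab)).
move=> /(_ cxP (LRcontinuous_derive ab (dP x))).
have DP : {in `]a, b[, (@powR R ^~ x)^`()%classic =1 (fun t => x * t `^ (x - 1))}.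
  move=> t; rewrite in_itv/= => /andP[? ?].
  by rewrite derive1E; have [|_ ->//] := dP x t; rewrite !ltW.
have DE : {in `]a, b[, (fun s : R => - expR (- s))^`()%classic =1 (fun t => expR (- t))}.
  move=> t; rewrite in_itv/= => /andP[? ?].
  by rewrite derive1E; have [|_ ->//] := dE t; rewrite !ltW.
move=> /(_ DP cE (LRcontinuous_derive ab dE) DE).
have -> : (\int[mu]_(t in exhaust n) (gamma_density (x + 1) t)%:E =
  \int[mu]_(t in exhaust n) (t `^ x * expR (- t))%:E)%E.
  by apply: eq_integral => t _; rewrite /gamma_density addrK.
move=> ->.
congr (_ + _)%E; first by congr EFin; rewrite !mulrN; ring.
have -> : (\int[mu]_(t in exhaust n) (x * t `^ (x - 1) * - expR (- t))%:E =
  \int[mu]_(t in exhaust n) - (x%:E * (gamma_density x t)%:E))%E.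
  by apply: eq_integral => t _; rewrite mulrN -mulrA EFinN EFinM.
have mg : measurable_fun (exhaust n) (fun t => (gamma_density x t)%:E).
  by apply/measurable_EFinP; apply: measurable_funTS; exact: measurable_gamma_density.
have g0 t : (0 <= (gamma_density x t)%:E)%E by rewrite lee_fin gamma_density_ge0.
rewrite integral_ge0N/=; last first.
  by move=> t _; rewrite mule_ge0// lee_fin ltW.
rewrite oppeK ge0_integralZl//.
- exact: measurable_itv.
- by rewrite lee_fin ltW.
Qed.

Lemma cvg_harmonic_shift2 : (n.+2%:R^-1 : R) @[n --> \oo] --> (0 : R).
Proof.
have := @cvg_harmonic R; rewrite -(cvg_shiftn 1) /=.
by under eq_fun do rewrite addn1.
Qed.

(** The exponential dominates the single term [t ^ (m + 1) / (m + 1)!] of its series. This kills the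
    boundary term at infinity. *)
Lemma powR_expR_le (x : R) (m : nat) (t : R) : x <= m%:R -> 1 <= t ->
  t `^ x * expR (- t) <= m.+1`!%:R * t^-1.
Proof.
move=> xm t1.
have t0 : 0 < t by apply: lt_le_trans t1.
have h1 : t `^ x <= t ^+ m by rewrite -powR_mulrn ?(ltW t0)//; exact: ler_powR.
have h2 : t ^+ m.+1 <= m.+1`!%:R * expR t.
  rewrite mulrC -ler_pdivrMr ?ltr0n ?fact_gt0//.
  by apply: le_trans (expR_ge1Dxn m (ltW t0)); rewrite lerDr.
rewrite expRN ler_pdivrMr ?expR_gt0// mulrAC ler_pdivlMr//.
apply: le_trans h2; rewrite exprSr.
by rewrite ler_pM2r.
Qed.

Lemma cvg_boundary (x : R) : 0 < x ->
  (n.+2%:R^-1 `^ x * expR (- n.+2%:R^-1) - n.+2%:R `^ x * expR (- n.+2%:R) : R)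
    @[n --> \oo] --> (0 : R).
Proof.
move=> x0; rewrite -[X in _ --> X](subr0 0); apply: cvgB; last first.
  pose m := (Num.truncn x).+1.
  have xm : x <= m%:R by rewrite ltW// truncnS_gt.
  apply: (@squeeze_cvgr _ _ _ _ (cst 0) (fun n : nat => m.+1`!%:R * n.+2%:R^-1)).
  - near=> n; rewrite mulr_ge0 ?powR_ge0 ?expR_ge0//=.
    by apply: powR_expR_le => //; rewrite ler1n.
  - exact: cvg_cst.
  - rewrite -[X in _ --> X](mulr0 m.+1`!%:R).
    by apply: cvgM; [exact: cvg_cst|exact: cvg_harmonic_shift2].
(* [powR_cvg0] is a right-sided limit at 0, so the sequence has to approach 0 through positive
   values. *)
have H : (n.+2%:R^-1 : R) @[n --> \oo] --> (0 : R)^'+.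
  move=> A HA; have HA' : nbhs (0 : R) (fun y => 0 < y -> A y) := HA.
  have h : \forall n \near \oo, 0 < (n.+2%:R^-1 : R) -> A n.+2%:R^-1.
    exact: (cvg_harmonic_shift2 HA').
  have h' : \forall n \near \oo, A n.+2%:R^-1.
    by apply: filterS h => n; apply; rewrite invr_gt0.
  exact: h'.
have H1 := cvg_comp _ _ H (powR_cvg0 x0).
apply: (@squeeze_cvgr _ _ _ _ (cst 0) (fun n : nat => n.+2%:R^-1 `^ x)) => //.
- near=> n; rewrite mulr_ge0 ?powR_ge0 ?expR_ge0//=.
  rewrite ler_piMr ?powR_ge0// -expR0 ler_expR oppr_le0 invr_ge0//.
- exact: cvg_cst.
Unshelve. all: by end_near. Qed.

Lemma gammae_ge0 (x : R) : (0 <= gammae x)%E.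
Proof. by apply: integral_ge0 => t _; rewrite lee_fin gamma_density_ge0. Qed.

(** Let [n] tend to infinity in [gamma_exhaust_recursion]: monotone convergence handles both
    integrals, even if they are infinite, and the boundary terms tend to 0. *)
Lemma gammae_recursion (x : R) : 0 < x -> gammae (x + 1) = (x%:E * gammae x)%E.
Proof.
move=> x0.
have H1 := cvg_exhaust (measurable_gamma_density (x + 1)) (@gamma_density_ge0 (x + 1)).
have H2 := cvg_exhaust (measurable_gamma_density x) (@gamma_density_ge0 x).
have H3 := @cvgeZl _ _ _ _ _ x%:E isT H2.
have H4 : ((n.+2%:R^-1 `^ x * expR (- n.+2%:R^-1) - n.+2%:R `^ x * expR (- n.+2%:R))%:E
    : \bar R) @[n --> \oo] --> 0%:E.
  by apply: cvg_EFin (cvg_boundary x0); exact: nearW.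
have H5 := cvgeD _ H4 H3.
have : (\int[mu]_(t in exhaust n) (gamma_density (x + 1) t)%:E)%E @[n --> \oo] -->
  (0%:E + x%:E * gammae x)%E.
  under eq_fun do rewrite gamma_exhaust_recursion//.
  exact: H5.
rewrite add0e => H6.
exact: (cvg_unique _ H1 H6).
Qed.

Lemma gammae1 : gammae 1 = 1%E.
Proof.
have -> : gammae 1 = (\int[mu]_(t in `]0%R, +oo[%classic) (expR (- t))%:E)%E.
  by apply: eq_integral => t _; rewrite /gamma_density subrr powRr0 mul1r.
rewrite integral_itv_obnd_cbnd; last first.
  by apply/measurable_EFinP/measurable_funTS; apply: measurableT_comp.
have cE : continuous (fun s : R => expR (- s)).
  by move=> t; apply: continuous_comp; [exact: continuousN|exact: continuous_expR].
rewrite (@ge0_continuous_FTC2y _ _ (fun x => - (expR (- x))) _ 0).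
- by rewrite oppr0 expR0 EFinN oppeK add0e.
- by move=> t _; exact: expR_ge0.
- exact: continuous_subspaceT.
- by rewrite -oppr0; apply: cvgN; exact: cvgr_expR.
- by move=> t _; have [] := is_derive_Nexp t.
- by apply: cvgN; apply/cvg_at_right_filter; exact: cE.
- by move=> t _; rewrite derive1E; have [_ ->] := is_derive_Nexp t.
Qed.

Lemma gammae_nat (m : nat) : gammae m.+1%:R = (m`!%:R)%:E.
Proof.
elim: m => [|m IH]; first by rewrite gammae1.
by rewrite -natr1 gammae_recursion// IH factS natrM EFinM.
Qed.

Lemma gammae_lty (x : R) : 0 < x -> (gammae x < +oo)%E.
Proof.
(* At [x + 1] the density has no singularity at 0: it is at most the density of [gammae 1] for
   [t < 1] and that of [gammae m.+1] for [t >= 1], and both integrals are known factorials. *)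
move=> x0; suff : (gammae (x + 1) < +oo)%E.
  rewrite gammae_recursion//; case: (gammae x) (gammae_ge0 x) => //=.
  - by move=> r _ _; rewrite ltry.
  - by rewrite mulry gtr0_sg// mul1e.
pose m := (Num.truncn x).+1.
have xm : x <= m%:R by rewrite ltW// truncnS_gt.
have me (y : R) : measurable_fun (`]0%R, +oo[%classic : set R) (fun t => (gamma_density y t)%:E).
  by apply/measurable_EFinP; apply: measurable_funTS; exact: measurable_gamma_density.
apply: (@le_lt_trans _ _ (gammae 1 + gammae m.+1%:R)%E); last first.
  by rewrite gammae1 gammae_nat ltry.
rewrite -ge0_integralD//=; try by move=> t _; rewrite lee_fin gamma_density_ge0.
2, 3: exact: me.
apply: ge0_le_integral => //=.
- by move=> t _; rewrite lee_fin gamma_density_ge0.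
- exact: me.
- by apply: emeasurable_funD; exact: me.
move=> t; rewrite in_itv/= andbT => t0.
rewrite -EFinD lee_fin /gamma_density addrK subrr powRr0 mul1r -natr1 addrK.
have [t1|t1] := leP 1 t.
  by rewrite ler_wpDl ?expR_ge0// ler_wpM2r ?expR_ge0//; exact: ler_powR.
rewrite ler_wpDr ?mulr_ge0 ?powR_ge0 ?expR_ge0//.
rewrite ler_piMl ?expR_ge0//.
rewrite -(powRr0 t); apply: ger_powR; last exact: ltW.
by rewrite t0 ltW.
Qed.

Lemma gammaE (x : R) : 0 < x -> (Gamma x)%:E = gammae x.
Proof.
by move=> x0; rewrite /Gamma /Rintegral fineK// ge0_fin_numE ?gammae_lty// gammae_ge0.
Qed.

Lemma gamma_recursion (x : R) : 0 < x -> Gamma (x + 1) = x * Gamma x.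
Proof.
move=> x0; apply: EFin_inj; rewrite EFinM !gammaE ?gammae_recursion//.
by rewrite addr_gt0.
Qed.

Lemma gamma_nat (m : nat) : Gamma m.+1%:R = m`!%:R :> R.
Proof. by apply: EFin_inj; rewrite gammaE// gammae_nat. Qed.

(* The concave function [powR ^~ b] lies below its tangent at [x]. *)
Lemma powR_tangent (b x t : R) : 0 <= b <= 1 -> 0 < x -> 0 < t ->
  t `^ b <= (1 - b) * x `^ b + b * x `^ b * x^-1 * t.
Proof.
move=> /andP[b0 b1] x0 t0.
have [->|bn0] := eqVneq b 0; first by rewrite !powRr0; lra.
have [->|bn1] := eqVneq b 1.
  by rewrite !powRr1 ?(ltW x0) ?(ltW t0)// subrr mul0r add0r mul1r divff ?gt_eqF// mul1r.
have b0' : 0 < b by rewrite lt0r bn0.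
have b1' : 0 < 1 - b by rewrite subr_gt0 lt_neqAle bn1.
(* Young's inequality for the product of [(t / x) ^ b] and 1, with the conjugate exponents [1 / b]
   and [1 / (1 - b)]. *)
have := @conjugate_powR R ((t / x) `^ b) 1 b^-1 (1 - b)^-1.
rewrite !invrK powR1 /= mulr1 -powRrM divff ?gt_eqF// powRr1 ?(ltW (divr_gt0 t0 x0))//.
rewrite mul1r powR_ge0 !invr_gt0 => /(_ isT ler01 b0' b1' (subrKC _ _)) H.
have -> : t `^ b = x `^ b * (t / x) `^ b.
  rewrite -powRM ?(ltW x0) ?(ltW (divr_gt0 t0 x0))//; congr (_ `^ _); field.
  by rewrite gt_eqF.
apply: (@le_trans _ _ (x `^ b * (t / x * b + (1 - b)))).
  by rewrite ler_wpM2l ?powR_ge0.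
rewrite le_eqVlt; apply/orP; left; apply/eqP; ring.
Qed.

(** Wendel's inequality, used in place of log-convexity. Integrate the tangent bound at [x] against
    the density of [Gamma x]: the linear term produces [Gamma (x + 1) = x * Gamma x], and the two
    contributions add up to the right-hand side. *)
Lemma gamma_interpolation (x b : R) : 0 < x -> 0 <= b <= 1 ->
  Gamma (x + b) <= x `^ b * Gamma x.
Proof.
move=> x0 b01; have /andP[b0 b1] := b01.
have xb0 : 0 < x + b by rewrite ltr_pwDl.
have me (y : R) : measurable_fun (`]0%R, +oo[%classic : set R) (fun t => (gamma_density y t)%:E).
  by apply/measurable_EFinP; apply: measurable_funTS; exact: measurable_gamma_density.
have ge y t : (0 <= (gamma_density y t)%:E)%E by rewrite lee_fin gamma_density_ge0.
set c := (1 - b) * x `^ b; set e := b * x `^ b * x^-1.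
have c0 : 0 <= c by rewrite mulr_ge0 ?powR_ge0 ?subr_ge0.
have e0 : 0 <= e by rewrite !mulr_ge0 ?powR_ge0 ?invr_ge0 ?(ltW x0).
have -> : x `^ b * Gamma x = c * Gamma x + e * Gamma (x + 1).
  by rewrite gamma_recursion// /c /e; field; rewrite gt_eqF.
rewrite -lee_fin EFinD !EFinM !gammaE ?xb0 ?(addr_gt0 x0 ltr01)//.
have intZ (k y : R) : 0 <= k ->
    (k%:E * gammae y = \int[mu]_(t in `]0%R, +oo[%classic) (k%:E * (gamma_density y t)%:E))%E.
  move=> k0; rewrite ge0_integralZl//; first exact: me.
rewrite !intZ// -ge0_integralD//=; last 4 first.
- by move=> t _; rewrite mule_ge0.
- by apply: measurable_funeM; exact: me.
- by move=> t _; rewrite mule_ge0.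
- by apply: measurable_funeM; exact: me.
apply: ge0_le_integral => //=.
- exact: me.
- by apply: emeasurable_funD; apply: measurable_funeM; exact: me.
move=> t; rewrite in_itv/= andbT => t0.
rewrite -!EFinM -EFinD lee_fin /gamma_density addrK.
have tn0 (y z : R) : (y + z == 0) ==> (t != 0) by rewrite (gt_eqF t0) implybT.
have -> : t `^ (x + b - 1) = t `^ (x - 1) * t `^ b.
  by rewrite addrAC (@powRD _ t (x - 1) b) ?tn0.
have -> : t `^ x = t `^ (x - 1) * t.
  by rewrite -[X in _ = _ * X]powRr1 ?(ltW t0)// -(@powRD _ t (x - 1) 1) ?tn0// subrK.
have H := powR_tangent b01 x0 t0.
apply: (@le_trans _ _ (t `^ (x - 1) * expR (- t) * (c + e * t))); last first.
  by rewrite le_eqVlt; apply/orP; left; apply/eqP; rewrite /c /e; ring.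
by rewrite [leLHS]mulrAC ler_wpM2l ?mulr_ge0 ?powR_ge0 ?expR_ge0.
Qed.

Lemma gamma_ge0 (x : R) : 0 <= Gamma x.
Proof. by rewrite /Gamma; apply: Rintegral_ge0 => t _; exact: gamma_density_ge0. Qed.

(** A zero at [x] would propagate to [x + 1] by the functional equation, and interpolation from
    there to the integer [m + 2] would give [(m + 1)! <= 0]. *)
Lemma gamma_gt0 (x : R) : 0 < x -> 0 < Gamma x.
Proof.
move=> x0; rewrite lt0r gamma_ge0 andbT; apply/negP => /eqP H.
have Hn (k : nat) : Gamma (x + k%:R) = 0.
  elim: k => [|k IH]; first by rewrite addr0.
  by rewrite -natr1 addrA gamma_recursion ?IH ?mulr0// ltr_wpDr.
pose m := Num.truncn x.
have := @gamma_interpolation (x + 1) (m.+1%:R - x) (addr_gt0 x0 ltr01).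
rewrite (_ : x + 1 + _ = m.+2%:R); last by rewrite -[m.+2%:R]natr1; ring.
rewrite gamma_nat (Hn 1) mulr0 => /(_ _)/wrap[].
  have /andP[h1 h2] := truncn_itv (ltW x0).
  rewrite subr_ge0 (ltW h2)/= lerBlDr -natr1 addrC lerD2l//.
by rewrite leNgt ltr0n fact_gt0.
Qed.

End gamma.

(** * Discrete resolvents *)

Section rising_coefficients.
Context {R : realType}.
Implicit Types (u v w : nat -> R) (a b c : R).

Definition conv u v (n : nat) : R := \sum_(i < n.+1) u i * v (n - i)%N.

Lemma coef_poly_conv u v N n : (n < N)%N ->
  ((\poly_(i < N) u i) * (\poly_(i < N) v i))`_n = conv u v n.
Proof.
move=> nN; rewrite coefM; apply: eq_bigr => i _; rewrite !coef_poly.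
have iN : (i < N)%N by apply: leq_trans nN; rewrite ltn_ord.
by rewrite iN (leq_ltn_trans (leq_subr _ _) nN).
Qed.

(** Inherited from polynomial multiplication: the coefficient of index [n] of a product only sees
    the coefficients up to [n], so the sequences may be truncated. *)
Lemma convA u v w n : conv (conv u v) w n = conv u (conv v w) n.
Proof.
pose P (f : nat -> R) := \poly_(i < n.+1) f i.
have PE f i : (i < n.+1)%N -> (P f)`_i = f i by move=> h; rewrite coef_poly h.
have : (P u * P v * P w)`_n = (P u * (P v * P w))`_n by rewrite mulrA.
rewrite [LHS]coefM [RHS]coefM.
under eq_bigr => i _ do rewrite coef_poly_conv// PE ?ltnS ?leq_subr//.
under [in RHS]eq_bigr => i _ do
  rewrite coef_poly_conv ?ltnS ?leq_subr// PE//.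
by [].
Qed.

Lemma eq_convr u v w n : v =1 w -> conv u v n = conv u w n.
Proof. by move=> vw; apply: eq_bigr => i _; rewrite vw. Qed.

Lemma conv_linr u v w c n :
  conv u (fun k => v k - c * w k) n = conv u v n - c * conv u w n.
Proof.
rewrite /conv mulr_sumr -sumrB; apply: eq_bigr => i _.
by rewrite mulrBr mulrCA.
Qed.

Lemma conv_ge0 u v n : (forall k, 0 <= u k) -> (forall k, 0 <= v k) ->
  0 <= conv u v n.
Proof. by move=> u0 v0; apply: sumr_ge0 => i _; rewrite mulr_ge0. Qed.

(* The coefficient of z^n in (1 - z)^(-b). *)
Definition rising b (n : nat) : R := \prod_(j < n) ((b + j%:R) / j.+1%:R).

Lemma rising0 b : rising b 0 = 1. Proof. by rewrite /rising big_ord0. Qed.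

Lemma risingS b n : rising b n.+1 = rising b n * ((b + n%:R) / n.+1%:R).
Proof. by rewrite /rising big_ord_recr. Qed.

Lemma risingSM b n : n.+1%:R * rising b n.+1 = (b + n%:R) * rising b n.
Proof. by rewrite risingS; field; rewrite ?nat1r pnatr_eq0. Qed.

Lemma rising_ge0 b n : 0 <= b -> 0 <= rising b n.
Proof. by move=> b0; apply: prodr_ge0 => i _; rewrite divr_ge0 ?addr_ge0. Qed.

Lemma rising_0 n : rising 0 n = (n == 0)%:R.
Proof.
case: n => [|n]; first by rewrite rising0.
by rewrite /rising big_ord_recl /= addr0 mul0r mul0r.
Qed.

(** The Vandermonde identity, that is, [(1 - z)^(-b) (1 - z)^(-c) = (1 - z)^(-(b + c))]. The
    induction splits the factor [n + 1] as [i + (n + 1 - i)], which is the product rule for the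
    derivative of the generating functions. *)
Lemma conv_rising b c n : conv (rising b) (rising c) n = rising (b + c) n.
Proof.
elim: n => [|n IH]; first by rewrite /conv big_ord1 !rising0 mulr1.
have n0 : n.+1%:R != 0 :> R by rewrite pnatr_eq0.
apply: (mulfI n0); rewrite risingSM -IH /conv !mulr_sumr.
transitivity (\sum_(i < n.+2) (i%:R * rising b i * rising c (n.+1 - i) +
    (n.+1 - i)%:R * rising c (n.+1 - i) * rising b i)).
  apply: eq_bigr => i _; rewrite natrB ?leq_ord//; ring.
rewrite big_split/= big_ord_recl mul0r mul0r add0r.
rewrite [X in _ + X]big_ord_recr/= subnn mul0r mul0r addr0 -big_split/=.
apply: eq_bigr => i _.
rewrite /bump/= add1n risingSM subSS subSn ?leq_ord// risingSM natrB ?leq_ord//.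
ring.
Qed.

Section resolvent.
Variables (a mu : R).
Hypothesis (a01 : 0 < a < 1) (mu0 : 0 <= mu).

Let A := rising a.
Let F (r : nat -> R) (n : nat) : R :=
  (A n - mu * \sum_(j < n) A j.+1 * r (n - j.+1)%N) / (1 + mu).

(** Since [A 0 = 1], the equation [r + mu A * r = A] solved for [r n] reads [r = F r], where [F r n]
    only uses [r] below [n]. Hence [n + 1] iterations already give the final value at [n]. *)
Definition resolvent (n : nat) : R := iter n.+1 F (fun=> 0) n.

Lemma iter_resolvent n k : (n < k)%N -> iter k F (fun=> 0) n = resolvent n.
Proof.
elim/ltn_ind: n k => n IH [//|k] nk; rewrite /resolvent !iterS /F.
congr ((_ - _ * _) / _); apply: eq_bigr => j _; congr (_ * _).
have jn : (n - j.+1 < n)%N by rewrite ltn_subrL/= (leq_ltn_trans _ (ltn_ord j)).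
by rewrite !IH// (leq_trans jn).
Qed.

Lemma resolventE n :
  (1 + mu) * resolvent n = A n - mu * \sum_(j < n) A j.+1 * resolvent (n - j.+1).
Proof.
have mu1 : 1 + mu != 0 by rewrite gt_eqF// ltr_pwDl.
rewrite {1}/resolvent iterS {1}/F mulrCA divff// mulr1.
congr (_ - _ * _); apply: eq_bigr => j _; congr (_ * _).
by apply: iter_resolvent; rewrite ltn_subrL/= (leq_ltn_trans _ (ltn_ord j)).
Qed.

Lemma resolvent_conv n : resolvent n = A n - mu * conv A resolvent n.
Proof.
rewrite /conv big_ord_recl subn0 {2}/A rising0 mul1r.
have := resolventE n => H.
under eq_bigr do rewrite lift0.
by apply: (@addIr _ (mu * resolvent n)); rewrite mulrDr; lra.
Qed.

(* Kaluza's argument: the ratios [A n.+1 / A n] increase with [n]. *)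
Lemma resolvent_ge0 n : 0 <= resolvent n.
Proof.
have /andP[a0 a1] := a01.
elim/ltn_ind: n => -[_|n IH].
  have := resolventE 0; rewrite big_ord0 mulr0 subr0 /A rising0 => H.
  by rewrite -(@pmulr_rge0 _ (1 + mu)) ?H// ltr_pwDl.
rewrite -(@pmulr_rge0 _ (1 + mu)) ?ltr_pwDl// resolventE.
pose q (k : nat) : R := (a + k%:R) / k.+1%:R.
have AS k : A k.+1 = q k * A k by rewrite /A risingS mulrC.
have q_homo (j k : nat) : (j <= k)%N -> q j <= q k.
  move=> jk; rewrite /q ler_pdivrMr// mulrAC ler_pdivlMr//.
  rewrite -!natr1 -subr_ge0.
  have -> : (a + k%:R) * (j%:R + 1) - (a + j%:R) * (k%:R + 1) =
    (1 - a) * (k%:R - j%:R) by ring.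
  by rewrite mulr_ge0// subr_ge0 ?ler_nat// ltW.
have A0 k : 0 <= A k by apply: rising_ge0; exact: ltW.
(* Inserting the resolvent equation at [n] into [A n.+1 = q n * A n] turns [(1 + mu) * r n.+1] into
   [q n * r n + mu] times the sum of [(q n - q i) * A i * r (n - i)], whose terms are nonnegative by
   monotonicity of [q] and induction. *)
have HA : A n.+1 = q n * (resolvent n + mu * conv A resolvent n).
  by rewrite AS {1}(_ : A n = resolvent n + mu * conv A resolvent n)// [in RHS]resolvent_conv; ring.
have q0 : 0 <= q n by rewrite divr_ge0// addr_ge0// ltW.
have qr : 0 <= q n * resolvent n by apply: mulr_ge0 => //; exact: IH.
rewrite HA mulrDr -addrA addr_ge0 ?qr//.
rewrite [q n * (mu * _)]mulrCA -mulrBr mulr_ge0// /conv mulr_sumr -sumrB.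
apply: sumr_ge0 => i _.
rewrite subSS AS mulrA -mulrBl mulr_ge0 ?IH ?ltnS ?leq_subr//.
by rewrite -mulrBl mulr_ge0// subr_ge0 q_homo// -ltnS.
Qed.

Lemma resolvent_le n : resolvent n <= A n.
Proof.
have /andP[a0 a1] := a01.
rewrite resolvent_conv gerBl mulr_ge0// conv_ge0//; last exact: resolvent_ge0.
by move=> k; apply: rising_ge0; exact: ltW.
Qed.

(** Neumann series with exact remainder: substitute the resolvent equation into itself [K] times.
    The [k]-fold convolution power of [A] is [rising (k * a)] by the Vandermonde identity. *)
Lemma resolvent_expansion K n :
  resolvent n = \sum_(k < K) (- mu) ^+ k * rising (k%:R * a + a) n +
    (- mu) ^+ K * conv (rising (K%:R * a)) resolvent n.
Proof.
elim: K => [|K IH].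
  rewrite big_ord0 add0r expr0 mul1r mul0r /conv big_ord_recl subn0 rising0 mul1r.
  by rewrite big1 ?addr0// => i _; rewrite rising_0/= mul0r.
rewrite big_ord_recr/= {1}IH -addrA; congr (_ + _).
rewrite (eq_convr _ _ resolvent_conv) conv_linr conv_rising -convA.
have -> : conv (conv (rising (K%:R * a)) A) resolvent n =
  conv (rising (K.+1%:R * a)) resolvent n.
  apply: eq_bigr => i _; rewrite conv_rising; congr (rising _ _ * _).
  by rewrite -natr1 mulrDl mul1r.
rewrite exprSr; ring.
Qed.

Lemma conv_resolvent_ge0 K n : 0 <= conv (rising (K%:R * a)) resolvent n.
Proof.
have /andP[a0 a1] := a01.
by apply: conv_ge0 => k; [apply: rising_ge0; rewrite mulr_ge0// ltW|exact: resolvent_ge0].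
Qed.

Lemma rising_partial_ge0 K n :
  0 <= \sum_(k < K.*2.+1) (- mu) ^+ k * rising (k%:R * a + a) n.
Proof.
have := resolvent_expansion K.*2.+1 n; rewrite exprS -mul2n exprM sqrrN => H.
have H1 := resolvent_ge0 n; have H2 := conv_resolvent_ge0 (2 * K).+1 n.
have : 0 <= mu * (mu ^+ 2) ^+ K * conv (rising ((2 * K).+1%:R * a)) resolvent n.
  by rewrite !mulr_ge0 ?exprn_ge0.
rewrite !mulNr in H; lra.
Qed.

Lemma rising_partial_le K n :
  \sum_(k < K.*2) (- mu) ^+ k * rising (k%:R * a + a) n <= rising a n.
Proof.
have := resolvent_expansion K.*2 n; rewrite -mul2n exprM sqrrN => H.
have H1 := resolvent_le n; have H2 := conv_resolvent_ge0 (2 * K) n.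
have : 0 <= (mu ^+ 2) ^+ K * conv (rising ((2 * K)%:R * a)) resolvent n.
  by rewrite !mulr_ge0 ?exprn_ge0.
move: H1; rewrite /A; lra.
Qed.

End resolvent.

End rising_coefficients.

(** * Bounds for the Mittag-Leffler function *)

Section mittag_leffler_bounds.
Context {R : realType}.

Lemma gamma_rising (b : R) n : 0 < b -> Gamma (b + n%:R) = Gamma b * n`!%:R * rising b n.
Proof.
move=> b0; elim: n => [|n IH]; first by rewrite addr0 rising0 !mulr1.
rewrite -natr1 addrA gamma_recursion ?ltr_wpDr// IH risingS factS natrM.
by field; rewrite nat1r pnatr_eq0.
Qed.

Let v (b : R) (n : nat) : R := n.+1%:R `^ (1 - b) * rising b n.+1.

(** Passing from [b] to [b + 1] costs a factor tending to [1 / b], in accordance with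
    [Gamma (b + 1) = b * Gamma b]. *)
Let vS (b : R) n : 0 < b -> v (b + 1) n = v b n * (n.+1%:R^-1 + b^-1).
Proof.
move=> b0; have n0 : n.+1%:R != 0 :> R by rewrite pnatr_eq0.
have H : rising (b + 1) n.+1 = rising b n.+1 * ((b + n.+1%:R) / b).
  have b1 : 0 < b + 1 by rewrite addr_gt0.
  have := gamma_rising n.+1 b1; have := gamma_rising n.+2 b0.
  rewrite (_ : b + n.+2%:R = b + 1 + n.+1%:R); last by rewrite -[n.+2%:R]natr1; ring.
  move=> ->.
  rewrite gamma_recursion// factS natrM risingS => H.
  have G0 := gamma_gt0 b0; have f0 : 0 < n.+1`!%:R :> R by rewrite ltr0n fact_gt0.
  have bG : b * Gamma b * n.+1`!%:R != 0 by rewrite !mulf_neq0 ?gt_eqF.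
  apply: (mulfI bG); rewrite -H; field.
  by rewrite gt_eqF// -natrD pnatr_eq0.
rewrite /v H opprD addrA powRB ?n0 ?implybT// powRr1//.
by field; rewrite (gt_eqF b0) nat1r pnatr_eq0.
Qed.

(** With [x = n + 1], interpolation from [x] to [x + b] gives the upper bound of the squeeze, and
    interpolation from [x + b] to [x + 1] the lower one. *)
Let v_cvg01 (b : R) : 0 < b <= 1 -> v b n @[n --> \oo] --> (Gamma b)^-1.
Proof.
move=> /andP[b0 b1]; have G0 := gamma_gt0 b0.
apply: (@squeeze_cvgr _ _ _ _ (fun n : nat => (Gamma b)^-1 * (1 + b * n.+1%:R^-1)^-1)
  (fun=> (Gamma b)^-1)); last exact: cvg_cst; last first.
  rewrite -[X in _ --> X]mulr1; apply: cvgM; first exact: cvg_cst.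
  rewrite -[X in _ --> X]invr1; apply: cvgV; first exact: oner_neq0.
  rewrite -[X in _ --> X]addr0; apply: cvgD; first exact: cvg_cst.
  rewrite -[X in _ --> X](mulr0 b); apply: cvgM; first exact: cvg_cst.
  exact: cvg_harmonic.
near=> n; set x : R := n.+1%:R.
have x0 : 0 < x by rewrite ltr0n.
have f0 : 0 < n.+1`!%:R :> R by rewrite ltr0n fact_gt0.
have vE : v b n = (Gamma b)^-1 * (x `^ (1 - b) * Gamma (x + b) / n.+1`!%:R).
  rewrite [x + b]addrC gamma_rising// /v -/x; field.
  by rewrite !gt_eqF.
have GE : Gamma x = n.+1`!%:R / x.
  by rewrite gamma_nat factS natrM -/x mulrAC divff ?gt_eqF// mul1r.
have b01 : 0 <= b <= 1 by rewrite ltW.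
rewrite vE; apply/andP; split.
  rewrite ler_pM2l ?invr_gt0//.
  have xb0 : 0 < x + b by rewrite addr_gt0.
  have := @gamma_interpolation _ (x + b) (1 - b) xb0.
  rewrite (_ : x + b + (1 - b) = x + 1); last by ring.
  rewrite gamma_recursion// GE mulrCA divff ?gt_eqF// mulr1 => H.
  have {}H : n.+1`!%:R <= (x + b) `^ (1 - b) * Gamma (x + b).
    by apply: H; rewrite subr_ge0 b1 gerBl ltW.
  rewrite ler_pdivlMr//.
  apply: (@le_trans _ _ ((1 + b / x)^-1 * ((x + b) `^ (1 - b) * Gamma (x + b)))).
    by rewrite ler_wpM2l// invr_ge0 addr_ge0// divr_ge0 // ltW.
  rewrite mulrA ler_wpM2r ?gamma_ge0//.
  set y := 1 + b / x.
  have y1 : 1 <= y by rewrite lerDl divr_ge0// ltW.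
  have y0 : 0 < y by apply: lt_le_trans y1.
  have -> : x + b = y * x by rewrite /y; field; rewrite gt_eqF.
  rewrite powRM ?(ltW y0) ?(ltW x0)// mulrA ler_piMl ?powR_ge0//.
  rewrite mulrC ler_pdivrMr// mul1r.
  by apply: ler1_powR => //; rewrite gerBl ltW.
rewrite ler_piMr ?invr_ge0 ?(ltW G0)//.
rewrite ler_pdivrMr// mul1r.
have := @gamma_interpolation _ x b x0 b01; rewrite GE => H.
apply: (le_trans (ler_wpM2l (powR_ge0 _ _) H)).
rewrite !mulrA -powRD ?(gt_eqF x0) ?implybT// subrK powRr1 ?(ltW x0)//.
by rewrite mulrAC divff ?gt_eqF// mul1r.
Unshelve. all: by end_near. Qed.

(* Gauss' limit formula for [1 / Gamma b]. *)
Lemma cvg_rising (b : R) : 0 < b ->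
  n.+1%:R `^ (1 - b) * rising b n.+1 @[n --> \oo] --> (Gamma b)^-1.
Proof.
move=> b0.
suff H (k : nat) (c : R) : 0 < c <= 1 -> v (c + k%:R) n @[n --> \oo] --> (Gamma (c + k%:R))^-1.
  pose k := Num.truncn b.
  have /andP[h1 h2] := truncn_itv (ltW b0).
  (* For an integer [b] the fractional part 0 lies outside the base interval [0 < c <= 1], so the
     induction starts from [c = 1] with one step fewer. *)
  have [e|ne] := eqVneq b k%:R.
    have k0 : (0 < k)%N by rewrite -(ltr0n R) -e.
    have := H k.-1 1; rewrite ltr01 lexx nat1r prednK// -e => /(_ isT).
    exact.
  have := H k (b - k%:R); rewrite subrK; apply.
  by rewrite subr_gt0 lt_neqAle eq_sym ne h1/= lerBlDr nat1r ltW.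
elim: k c => [|k IH] c /[dup] c01 /andP[c0 c1]; first by rewrite addr0; exact: v_cvg01.
have ck : 0 < c + k%:R by rewrite ltr_wpDr.
rewrite -natr1 addrA gamma_recursion// invfM mulrC.
under eq_fun do rewrite vS//.
apply: cvgM; first exact: IH.
rewrite -[X in _ --> X]add0r; apply: cvgD; last exact: cvg_cst.
exact: cvg_harmonic.
Qed.

Section coefficients.
Variable a : R.
Hypothesis a01 : 0 < a < 1.

Let a0 : 0 < a. Proof. by case/andP: a01. Qed.
Let a1 : a < 1. Proof. by case/andP: a01. Qed.

Let beta (k : nat) : R := k%:R * a + a.

Let beta_gt0 k : 0 < beta k. Proof. by rewrite ltr_wpDl// mulr_ge0// ltW. Qed.

Definition ml_coef (x : R) (k : nat) : R := x ^+ k / Gamma (k%:R * a + a).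

Lemma cvg_partial_ml (x : R) K : 0 <= x ->
  n.+1%:R `^ (1 - a) *
    (\sum_(k < K) (- (x * n.+1%:R `^ (- a))) ^+ k * rising (k%:R * a + a) n.+1)
   @[n --> \oo] --> series (ml_coef (- x)) K.
Proof.
move=> x0; elim: K => [|K IH].
  rewrite /series/= big_geq//; under eq_fun do rewrite big_ord0 mulr0.
  exact: cvg_cst.
rewrite seriesSr; under eq_fun do rewrite big_ord_recr/= mulrDr.
apply: cvgD; first exact: IH.
have -> : (fun n : nat => n.+1%:R `^ (1 - a) * ((- (x * n.+1%:R `^ (- a))) ^+ K *
    rising (K%:R * a + a) n.+1)) =
  (fun n : nat => (- x) ^+ K * (n.+1%:R `^ (1 - beta K) * rising (beta K) n.+1)).
  apply/funext => n; rewrite -mulNr exprMn -(@powR_mulrn _ (n.+1%:R `^ _) K) ?powR_ge0//.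
  rewrite -powRrM.
  have n0 : (n.+1%:R == 0 :> R) = false by rewrite pnatr_eq0.
  (* The factor [n.+1 ^ (1 - a)] and the [K]-th power of [n.+1 ^ (- a)] combine exactly to the
     weight of Gauss' formula for [beta K]. *)
  have -> : 1 - beta K = 1 - a + - a * K%:R by rewrite /beta; ring.
  by rewrite (@powRD _ _ (1 - a)) ?n0 ?implybT// /beta; ring.
by apply: cvgM; [exact: cvg_cst|exact: cvg_rising].
Qed.

Lemma series_ml_ge0 (x : R) K : 0 <= x -> 0 <= series (ml_coef (- x)) K.*2.+1.
Proof.
move=> x0; have H := @cvg_partial_ml x K.*2.+1 x0.
rewrite -(cvg_lim _ H)//; apply: limr_ge; first by apply/cvg_ex; eexists; exact: H.
near=> n; rewrite mulr_ge0 ?powR_ge0// rising_partial_ge0//.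
by rewrite mulr_ge0 ?powR_ge0.
Unshelve. all: by end_near. Qed.

Lemma series_ml_le (x : R) K : 0 <= x -> series (ml_coef (- x)) K.*2 <= (Gamma a)^-1.
Proof.
move=> x0; have H := @cvg_partial_ml x K.*2 x0.
have G := cvg_rising a0.
rewrite -(cvg_lim _ H)// -(cvg_lim _ G)//; apply: ler_lim.
- by apply/cvg_ex; eexists; exact: H.
- by apply/cvg_ex; eexists; exact: G.
near=> n; rewrite ler_wpM2l ?powR_ge0// rising_partial_le//.
by rewrite mulr_ge0 ?powR_ge0.
Unshelve. all: by end_near. Qed.

(** Interpolation from [b + a] to [b + 1] gives [b * Gamma b <= (b + a) ^ (1 - a) * Gamma (b + a)];
    then [b + a <= 2 * b], and [2 ^ (1 - a) <= 2]. *)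
Lemma gamma_ratio (b : R) : a <= b ->
  Gamma b / Gamma (b + a) <= 2 * b `^ (- a).
Proof.
move=> ab; have b0 : 0 < b by apply: lt_le_trans ab.
have ba0 : 0 < b + a by rewrite addr_gt0.
rewrite ler_pdivrMr ?gamma_gt0//.
have := @gamma_interpolation _ (b + a) (1 - a) ba0.
rewrite (_ : b + a + (1 - a) = b + 1); last by ring.
rewrite gamma_recursion// subr_ge0 (ltW a1) gerBl (ltW a0) => /(_ isT) H.
rewrite -(@ler_pM2l _ b)//; apply: (le_trans H).
rewrite mulrA ler_wpM2r ?gamma_ge0//.
have -> : b * (2 * b `^ (- a)) = 2 * b `^ (1 - a).
  by rewrite (@powRD _ b 1 (- a)) ?(gt_eqF b0) ?implybT// powRr1 ?(ltW b0)//; ring.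
apply: (@le_trans _ _ ((2 * b) `^ (1 - a))).
  apply: ge0_ler_powR; rewrite ?nnegrE ?subr_ge0 ?(ltW a1) ?(ltW ba0) ?mulr_ge0 ?(ltW b0)//.
  by rewrite mulr_natl mulr2n lerD2l.
rewrite powRM ?(ltW b0)// ler_wpM2r ?powR_ge0//.
by apply: ler1_powR; rewrite ?ler1n// gerBl ltW.
Qed.

(** Ratio test: by [gamma_ratio] the sequence [w k], the coefficient times [2 ^ k], is nonincreasing
    as soon as [beta k ^ a >= 4 * x], which holds from [k0] on. *)
Lemma ml_coef_geometric (x : R) : 0 < x ->
  exists2 C : R, 0 <= C & forall k, ml_coef x k <= C * 2^-1 ^+ k.
Proof.
move=> x0.
have u0 k : 0 <= ml_coef x k by rewrite divr_ge0 ?gamma_ge0 ?exprn_ge0// ltW.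
pose w k := ml_coef x k * 2 ^+ k.
have w0 k : 0 <= w k by rewrite mulr_ge0 ?exprn_ge0.
have wE k : ml_coef x k = w k * 2^-1 ^+ k.
  by rewrite /w exprVn mulfK// expf_neq0.
pose k0 := (Num.truncn ((4 * x) `^ a^-1 / a)).+1.
have wS k : (k0 <= k)%N -> w k.+1 <= w k.
  move=> kk.
  have hb : (4 * x) `^ a^-1 <= beta k.
    rewrite /beta.
    apply: (@le_trans _ _ (k%:R * a)); last by rewrite lerDl ltW.
    rewrite -ler_pdivrMr//; apply: (le_trans (ltW (truncnS_gt _))).
    by rewrite ler_nat.
  have hb2 : 4 * x <= beta k `^ a.
    have x4 : 0 <= 4 * x by rewrite mulr_ge0// ltW.
    have -> : 4 * x = ((4 * x) `^ a^-1) `^ a.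
      by rewrite -powRrM mulVf ?gt_eqF// powRr1.
    apply: (ge0_ler_powR (ltW a0)) => //; first by rewrite nnegrE powR_ge0.
    by rewrite nnegrE ltW.
  have ab : a <= beta k by rewrite lerDr mulr_ge0// ltW.
  have := gamma_ratio ab.
  have G1 := gamma_gt0 (beta_gt0 k); have G2 := gamma_gt0 (beta_gt0 k.+1).
  have bS : beta k + a = beta k.+1 by rewrite /beta -natr1 mulrDl mul1r.
  rewrite bS powRN => H.
  have -> : w k.+1 = w k * (2 * x * (Gamma (beta k) / Gamma (beta k.+1))).
    rewrite /w /ml_coef -/(beta k) -/(beta k.+1) !exprS; field.
    by rewrite !gt_eqF.
  rewrite ler_piMr//.
  have p0 : 0 < beta k `^ a by rewrite powR_gt0.
  apply: (@le_trans _ _ (2 * x * (2 / beta k `^ a))).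
    by rewrite ler_wpM2l// mulr_ge0// ltW.
  by rewrite mulrA ler_pdivrMr// mul1r; apply: le_trans hb2; lra.
(* This sum of nonnegative terms bounds every [w j] with [j <= k0], hence also the later ones, which
   are at most [w k0]. *)
exists (\sum_(j < k0.+1) w j); first exact: sumr_ge0.
move=> k; rewrite wE ler_wpM2r ?exprn_ge0//.
have wle j : (j <= k0)%N -> w j <= \sum_(j < k0.+1) w j.
  by move=> jk; rewrite (bigD1 (Ordinal (jk : (j < k0.+1)%N)))//= lerDl sumr_ge0.
have [kk|/ltnW] := leqP k k0; first exact: wle.
move=> /subnKC <-; elim: (k - k0)%N => [|m IH]; first by rewrite addn0 wle.
by rewrite addnS; apply: le_trans IH; rewrite wS// leq_addr.
Qed.

Lemma is_cvg_series_ml (x : R) : 0 <= x -> cvgn (series (ml_coef (- x))).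
Proof.
move=> x0; apply: normed_cvg.
have u0 k : 0 <= `|ml_coef (- x) k| by [].
(* The geometric bound asks for a positive argument while [x] may be 0, so the comparison is made at
   [x + 1]. *)
have y0 : 0 < x + 1 by rewrite ltr_wpDl.
have [C C0 HC] := ml_coef_geometric y0.
apply: (@series_le_cvg _ _ (geometric C 2^-1)) => //.
- by move=> k; rewrite /geometric/= mulr_ge0 ?exprn_ge0.
- move=> k; apply: le_trans (HC k); rewrite /ml_coef /= normrM normrX normrN.
  rewrite [`|_^-1|]ger0_norm ?invr_ge0 ?gamma_ge0// ler_wpM2r ?invr_ge0 ?gamma_ge0//.
  by rewrite lerXn2r ?nnegrE ?(ltW y0)// ger0_norm// lerDl.
- by apply: is_cvg_geometric_series; rewrite ger0_norm// invf_lt1// ltr1n.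
Qed.

(** The series converges, so its sum is the limit along odd truncations, which are nonnegative, and
    along even ones, which are at most [1 / Gamma a]. *)
Lemma mittag_leffler_bounds (x : R) : 0 <= x ->
  0 <= mittag_leffler a a (- x) <= (Gamma a)^-1.
Proof.
move=> x0; have H := is_cvg_series_ml x0.
have cvg2 : (fun n : nat => n.*2) x @[x --> \oo] --> \oo.
  move=> A [N _ NA]; exists N => // n /= Nn; apply: NA.
  by rewrite /= (leq_trans Nn)// -addnn leq_addr.
have cvg2S : (fun n : nat => n.*2.+1) x @[x --> \oo] --> \oo.
  move=> A [N _ NA]; exists N => // n /= Nn; apply: NA.
  by rewrite /= (leq_trans Nn)// -addnn ltnW// ltnS leq_addr.
have He := cvg_comp _ _ cvg2 H; have Ho := cvg_comp _ _ cvg2S H.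
have -> : mittag_leffler a a (- x) = limn (series (ml_coef (- x))) by [].
apply/andP; split.
  rewrite -(cvg_lim _ Ho)//; apply: limr_ge; first by apply/cvg_ex; eexists; exact: Ho.
  by apply: nearW => n; exact: series_ml_ge0.
rewrite -(cvg_lim _ He)//; apply: limr_le; first by apply/cvg_ex; eexists; exact: He.
by apply: nearW => n; exact: series_ml_le.
Qed.

(** The absolute value keeps the argument on the half-line where the series is known to converge, so
    the function is a pointwise limit of measurable partial sums on the whole line. *)
Lemma measurable_mittag_leffler :
  measurable_fun setT (fun x : R => mittag_leffler a a (- `|x|)).
Proof.
pose s (n : nat) (x : R) := series (ml_coef (- `|x|)) n.
apply: (measurable_fun_cvg (h := s)) => //.
- move=> n; rewrite /s /series/=; under eq_fun do rewrite big_mkord.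
  apply: measurable_sum => k; rewrite /ml_coef.
  apply: measurable_funM => //; apply: measurable_funX.
  by apply: measurableT_comp => //; exact: measurableT_comp.
- by move=> x _; exact: is_cvg_series_ml.
Qed.

End coefficients.

End mittag_leffler_bounds.

(** * Orthonormal expansions in L2 *)

Section L2_space.
Context {R : realType} {d : nat} {Om : set (euclid R d)}.
Implicit Types (u v w : euclid R d -> R) (c : nat -> R) (phi : nat -> euclid R d -> R).
Notation mu := (lebesgue_nd R d).
Notation dot := (L2dot Om).

Let p1 : (1 <= 2%:E :> \bar R)%E. Proof. by rewrite lee_fin ler1n. Qed.

Lemma L2_addZ (k : R) u v : L2 Om u -> L2 Om v -> L2 Om (fun x => k * u x + v x).
Proof.
move=> hu hv; have [_ H] := Lfun_submod_closed mu p1.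
have E : (fun x => k * u x + v x) \_ Om = k *: (u \_ Om) + v \_ Om.
  by apply/funext => x; rewrite /patch !fctE /=; case: ifP => _; rewrite ?scaler0 ?addr0.
by rewrite /L2 E; exact: H.
Qed.

Lemma L2_0 : L2 Om (fun=> 0).
Proof.
have [H _] := Lfun_submod_closed mu p1.
have E : (fun=> 0) \_ Om = 0 :> (euclid R d -> R).
  by apply/funext => x; rewrite /patch; case: ifP.
by rewrite /L2 E.
Qed.

Lemma L2Z (k : R) u : L2 Om u -> L2 Om (fun x => k * u x).
Proof.
move=> hu; have := L2_addZ k hu L2_0; congr (L2 Om _).
by apply/funext => x; rewrite addr0.
Qed.

Lemma L2D u v : L2 Om u -> L2 Om v -> L2 Om (u \+ v).
Proof.
move=> hu hv; have := L2_addZ 1 hu hv; congr (L2 Om _).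
by apply/funext => x; rewrite mul1r.
Qed.

Lemma L2B u v : L2 Om u -> L2 Om v -> L2 Om (u \- v).
Proof.
move=> hu hv; have := L2_addZ (-1) hv hu; congr (L2 Om _).
by apply/funext => x; rewrite mulN1r addrC.
Qed.

Lemma L2_sum (I : Type) (s : seq I) (F : I -> euclid R d -> R) :
  (forall i, L2 Om (F i)) -> L2 Om (fun x => \sum_(i <- s) F i x).
Proof.
move=> hF; elim: s => [|i s IH].
  by have := L2_0; congr (L2 Om _); apply/funext => x; rewrite big_nil.
have := L2D (hF i) IH; congr (L2 Om _).
by apply/funext => x; rewrite big_cons.
Qed.

(** Extending by 0 moves the integral to the whole space, where membership in [L2] is expressed. *)
Lemma dotE u v : dot u v = \int[mu]_x ((u \_ Om) x * (v \_ Om) x).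
Proof.
rewrite /L2dot Rintegral_mkcond; congr Rintegral; apply/funext => x.
by rewrite /patch; case: ifP => //; rewrite mulr0.
Qed.

Lemma integrable_dot u v : L2 Om u -> L2 Om v ->
  mu.-integrable setT (EFin \o (fun x => (u \_ Om) x * (v \_ Om) x)).
Proof. by move=> hu hv; apply/Lfun1_integrable; exact: Lfun2_mul_Lfun1. Qed.

Lemma dotC u v : dot u v = dot v u.
Proof. by apply: eq_Rintegral => x _; rewrite mulrC. Qed.

Lemma dot_addZl (k : R) u v w : L2 Om u -> L2 Om v -> L2 Om w ->
  dot (fun x => k * u x + v x) w = k * dot u w + dot v w.
Proof.
move=> hu hv hw; rewrite !dotE -RintegralZl//; last exact: integrable_dot.
rewrite -RintegralD//; last 2 first.
- have := integrableZl measurableT k (integrable_dot hu hw).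
  by under [X in integrable _ _ X]eq_fun do rewrite -EFinM.
- exact: integrable_dot.
apply: eq_Rintegral => x _; rewrite /patch /=; case: ifP => _; [ring|]. by rewrite !mulr0 addr0.
Qed.

Lemma dot0l w : L2 Om w -> dot (fun=> 0) w = 0.
Proof.
move=> hw; have := dot_addZl 1 L2_0 L2_0 hw.
have -> : (fun x : euclid R d => 1 * 0 + 0) = (fun=> 0) :> (_ -> R).
  by apply/funext => x; rewrite mulr0 addr0.
lra.
Qed.

Lemma dotBl u v w : L2 Om u -> L2 Om v -> L2 Om w -> dot (u \- v) w = dot u w - dot v w.
Proof.
move=> hu hv hw; have := dot_addZl (-1) hv hu hw.
have -> : (fun x : euclid R d => -1 * v x + u x) = u \- v.
  by apply/funext => x; rewrite mulN1r addrC.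
by move=> ->; ring.
Qed.

Lemma dotBr u v w : L2 Om u -> L2 Om v -> L2 Om w -> dot w (u \- v) = dot w u - dot w v.
Proof. by move=> hu hv hw; rewrite dotC dotBl// ![dot w _]dotC. Qed.

Lemma dotZl (k : R) u w : L2 Om u -> L2 Om w -> dot (fun x => k * u x) w = k * dot u w.
Proof.
move=> hu hw; have := dot_addZl k hu L2_0 hw; rewrite dot0l// addr0 => <-.
by congr (dot _ w); apply/funext => x; rewrite addr0.
Qed.

Lemma dot_suml (I : Type) (s : seq I) (F : I -> euclid R d -> R) w :
  (forall i, L2 Om (F i)) -> L2 Om w ->
  dot (fun x => \sum_(i <- s) F i x) w = \sum_(i <- s) dot (F i) w.
Proof.
move=> hF hw; elim: s => [|i s IH].
  rewrite big_nil -[RHS](dot0l hw); congr (dot _ w).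
  by apply/funext => x; rewrite big_nil.
rewrite big_cons -IH -[dot (F i) w]mul1r -dot_addZl//; last exact: L2_sum.
by congr (dot _ w); apply/funext => x; rewrite big_cons mul1r.
Qed.

Lemma dot_ge0 u : 0 <= dot u u.
Proof. by apply: Rintegral_ge0 => x _; rewrite -expr2 sqr_ge0. Qed.

Lemma L2normE u : L2 Om u -> L2norm Om u = (Num.sqrt (dot u u))%:E.
Proof.
move=> hu; rewrite /L2norm unlock dotE.
have -> : (\int[mu]_x (`|(EFin \o u \_ Om) x| `^ 2) =
   \int[mu]_x ((u \_ Om) x * (u \_ Om) x)%:E)%E.
  apply: eq_integral => x _ /=.
  by rewrite powR_mulrn// -normrX ger0_norm ?sqr_ge0// expr2.
have fn := integrable_fin_num measurableT (integrable_dot hu hu).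
rewrite -(fineK fn) /= -/(Rintegral _ _ _) powR12_sqrt//.
by have := dot_ge0 u; rewrite dotE.
Qed.

Lemma dot_CS u v : L2 Om u -> L2 Om v -> dot u v ^+ 2 <= dot u u * dot v v.
Proof.
move=> hu hv.
have quad (t : R) : 0 <= dot u u - 2 * t * dot u v + t ^+ 2 * dot v v.
  have hw := L2_addZ (- t) hv hu.
  have := dot_ge0 (fun x => - t * v x + u x).
  rewrite dot_addZl// [dot v _]dotC [dot u _]dotC !dot_addZl// [dot v u]dotC.
  by congr (_ <= _); ring.
have [v0|v0] := eqVneq (dot v v) 0.
  have [->|uv0] := eqVneq (dot u v) 0; first by rewrite expr0n/= v0 mulr0.
  (* If [dot v v = 0] the quadratic is affine in [t]; this [t] would give it the value -1. *)
  have := quad ((dot u u + 1) / (2 * dot u v)).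
  have -> : 2 * ((dot u u + 1) / (2 * dot u v)) * dot u v = dot u u + 1 by field.
  by rewrite v0; lra.
have vp : 0 < dot v v by rewrite lt0r v0 dot_ge0.
have := quad (dot u v / dot v v).
have -> : dot u u - 2 * (dot u v / dot v v) * dot u v + (dot u v / dot v v) ^+ 2 * dot v v
  = dot u u - dot u v ^+ 2 / dot v v by field.
by rewrite subr_ge0 ler_pdivrMr.
Qed.

Lemma normr_dot_le u v : L2 Om u -> L2 Om v ->
  `|dot u v| <= Num.sqrt (dot u u) * Num.sqrt (dot v v).
Proof.
by move=> hu hv; rewrite -sqrtrM ?dot_ge0// -sqrtr_sqr ler_wsqrtr// dot_CS.
Qed.

Lemma L2norm_cvg0 (F : nat -> euclid R d -> R) : (forall k, L2 Om (F k)) ->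
  L2norm Om (F k) @[k --> \oo] --> 0%E ->
  dot (F k) (F k) @[k --> \oo] --> 0.
Proof.
move=> hF; have -> : (fun k => L2norm Om (F k)) = (fun k => (Num.sqrt (dot (F k) (F k)))%:E).
  by apply/funext => k; rewrite L2normE.
move=> /fine_cvgP[_ H].
have -> : (fun k => dot (F k) (F k)) =
    (fun k => Num.sqrt (dot (F k) (F k)) * Num.sqrt (dot (F k) (F k))).
  by apply/funext => k; rewrite -expr2 sqr_sqrtr// dot_ge0.
by rewrite -[X in _ --> X](mulr0 0); apply: cvgM; exact: H.
Qed.

Lemma cvg_dotl (F : nat -> euclid R d -> R) u w : (forall k, L2 Om (F k)) -> L2 Om u ->
  L2 Om w -> L2norm Om (F k \- u) @[k --> \oo] --> 0%E ->
  dot (F k) w @[k --> \oo] --> dot u w.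
Proof.
move=> hF hu hw; have hB k : L2 Om (F k \- u) by exact: L2B.
move=> /(L2norm_cvg0 hB) H.
have H2 : dot (F k \- u) w @[k --> \oo] --> 0.
  apply/norm_cvg0P.
  apply: (@squeeze_cvgr _ _ _ _ (cst 0)
    (fun k => Num.sqrt (dot (F k \- u) (F k \- u)) * Num.sqrt (dot w w))).
  - by apply: nearW => k; rewrite normr_ge0 normr_dot_le.
  - exact: cvg_cst.
  - rewrite -[X in _ --> X](mul0r (Num.sqrt (dot w w))); apply: cvgM; last exact: cvg_cst.
    rewrite -[X in _ --> X]sqrtr0.
    exact: (cvg_comp _ _ H (@sqrt_continuous R 0)).
have -> : (fun k => dot (F k) w) = (fun k => dot (F k \- u) w + dot u w).
  by apply/funext => k; rewrite dotBl// subrK.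
by rewrite -[X in _ --> X]add0r; apply: cvgD => //; exact: cvg_cst.
Qed.

Section orthonormal.
Variable phi : nat -> euclid R d -> R.
Hypothesis phiB : orthonormal_basis Om phi.

Let hphi n : (1 <= n)%N -> L2 Om (phi n). Proof. by case: phiB => + _ _; apply. Qed.

Lemma lincombE c N : lincomb phi c N = fun x => \sum_(n < N) c n.+1 * phi n.+1 x.
Proof. by apply/funext => x; rewrite /lincomb big_add1 big_mkord. Qed.

Lemma L2_lincomb c N : L2 Om (lincomb phi c N).
Proof. by rewrite lincombE; apply: L2_sum => n; apply: L2Z; exact: hphi. Qed.

Lemma dot_lincombl c N w : L2 Om w ->
  dot (lincomb phi c N) w = \sum_(n < N) c n.+1 * dot w (phi n.+1).
Proof.
move=> hw; rewrite lincombE dot_suml//; last by move=> n; apply: L2Z; exact: hphi.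
by apply: eq_bigr => n _; rewrite dotZl ?[dot w _]dotC//; exact: hphi.
Qed.

Lemma dot_lincomb_phi c N m : dot (lincomb phi c N) (phi m.+1) = if (m < N)%N then c m.+1 else 0.
Proof.
have [_ orth _] := phiB.
rewrite dot_lincombl; last exact: hphi.
case: ifPn => [mN|mN].
  rewrite (bigD1 (Ordinal mN))//= orth// eqxx mulr1 big1 ?addr0// => i.
  by rewrite -val_eqE/= => im; rewrite orth// eqSS eq_sym (negbTE im) mulr0.
rewrite big1// => i _; rewrite orth// eqSS.
have [e|ne] := eqVneq m i; last by rewrite mulr0.
by move: mN; rewrite e ltn_ord.
Qed.

Lemma dot_lincomb c N :
  dot (lincomb phi c N) (lincomb phi c N) = \sum_(n < N) c n.+1 ^+ 2.
Proof.
rewrite dot_lincombl; last exact: L2_lincomb.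
by apply: eq_bigr => n _; rewrite dot_lincomb_phi ltn_ord expr2.
Qed.

(** By continuity of the inner product, the coefficient of the remainder [v \- lincomb phi c N]
    tends to 0; by orthonormality it is constant in [N] once [N > m]. *)
Lemma L2sum_coef c v m : L2sum Om phi c v -> dot v (phi m.+1) = c m.+1.
Proof.
move=> [hv H].
have hN N : L2 Om (lincomb phi c N) by exact: L2_lincomb.
have hB N : L2 Om (v \- lincomb phi c N) by exact: L2B.
have hz : L2 Om (fun=> 0) := L2_0.
have H' : L2norm Om ((v \- lincomb phi c N) \- (fun=> 0)) @[N --> \oo] --> 0%E.
  suff -> : (fun N => L2norm Om ((v \- lincomb phi c N) \- (fun=> 0))) =
    (fun N => L2norm Om (v \- lincomb phi c N)) by [].
  by apply/funext => N; congr (L2norm Om _); apply/funext => x /=; rewrite subr0.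
have H2 := cvg_dotl hB hz (hphi (ltn0Sn m)) H'.
rewrite dot0l in H2; last exact: hphi.
apply/eqP; rewrite -subr_eq0; apply/eqP.
apply: (cvg_unique _ _ H2) => //.
apply: (@cvg_trans _ ((fun=> dot v (phi m.+1) - c m.+1) @ \oo)); last exact: cvg_cst.
apply: near_eq_cvg; near=> N.
rewrite dotBl//; last exact: hphi.
rewrite dot_lincomb_phi ifT//.
by near: N; exact: nbhs_infty_gt.
Unshelve. all: by end_near. Qed.

(** One half of Parseval: [dot v v] minus the [N]-th partial sum of squares is the squared norm of
    the remainder, which tends to 0 by completeness. *)
Lemma dot_le_coefs v (B : R) : L2 Om v ->
  (forall N, \sum_(n < N) dot v (phi n.+1) ^+ 2 <= B) -> dot v v <= B.
Proof.
move=> hv HB; have [_ _ /(_ _ hv)[_ H]] := phiB.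
set c := fun n => dot v (phi n).
have hN N : L2 Om (lincomb phi c N) by exact: L2_lincomb.
have hB N : L2 Om (v \- lincomb phi c N) by exact: L2B.
have H2 := L2norm_cvg0 hB H.
have E N : dot v v - B <= dot (v \- lincomb phi c N) (v \- lincomb phi c N).
  rewrite dotBl// !dotBr// [dot v (lincomb _ _ _)]dotC dot_lincomb.
  have -> : dot (lincomb phi c N) v = \sum_(n < N) c n.+1 ^+ 2.
    by rewrite dot_lincombl//; apply: eq_bigr => n _; rewrite expr2.
  by have := HB N; rewrite -/c; lra.
have : dot v v - B <= 0.
  rewrite -(cvg_lim _ H2)//; apply: limr_ge; first by apply/cvg_ex; eexists; exact: H2.
  exact: nearW.
by rewrite subr_le0.
Qed.

Lemma bessel v N : L2 Om v -> \sum_(n < N) dot v (phi n.+1) ^+ 2 <= dot v v.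
Proof.
move=> hv; set c := fun n => dot v (phi n).
have := dot_ge0 (v \- lincomb phi c N).
have hN : L2 Om (lincomb phi c N) by exact: L2_lincomb.
have hB : L2 Om (v \- lincomb phi c N) by exact: L2B.
rewrite dotBl// !dotBr// [dot v (lincomb _ _ _)]dotC dot_lincomb.
have -> : dot (lincomb phi c N) v = \sum_(n < N) c n.+1 ^+ 2.
  by rewrite dot_lincombl//; apply: eq_bigr => n _; rewrite expr2.
rewrite /c; lra.
Qed.

End orthonormal.
End L2_space.

(** * The source term *)

Section source_term.
Context {R : realType} {d : nat} {Om : set (euclid R d)}.
Variables (alpha tau : R).
Hypotheses (alpha01 : 0 < alpha < 1) (tau0 : 0 < tau).
Notation leb := (@lebesgue_measure R).
Notation dot := (L2dot Om).
Notation I0 := (`]0%R, tau[%classic : set R).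

Let alpha0 : 0 < alpha. Proof. by case/andP: alpha01. Qed.

Let kern (s : R) : R := (tau - s) `^ (alpha - 1).

Let kern_ge0 s : 0 <= kern s. Proof. exact: powR_ge0. Qed.

Let measurable_kern (D : set R) : measurable_fun D kern.
Proof.
apply: measurable_funTS; apply: (measurableT_comp (measurable_powR _)).
exact: measurable_funB.
Qed.

(** The kernel is singular at [tau], so the fundamental theorem of calculus is applied on intervals
    ending before [tau], and monotone convergence gives the rest. *)
Lemma integral_kernel_le :
  (\int[leb]_(s in I0) (kern s)%:E <= (tau `^ alpha / alpha)%:E)%E.
Proof.
pose A (n : nat) : set R := `[0, tau - tau / n.+2%:R]%classic.
have An n : tau / n.+2%:R < tau.
  by rewrite ltr_pdivrMr// ltr_pMr// ltr1n.
have ndA : nondecreasing_seq A.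
  move=> m n mn; rewrite subsetEset => s; rewrite /A/= !in_itv/= => /andP[-> h]/=.
  by apply: (le_trans h); rewrite lerD2l lerN2 ler_pM2l// lef_pV2 ?posrE// ler_nat.
have mA n : measurable (A n) by exact: measurable_itv.
have H : (\int[leb]_(s in A n) (kern s)%:E)%E @[n --> \oo] -->
    (\int[leb]_(s in \bigcup_n A n) (kern s)%:E)%E.
  apply: ge0_nondecreasing_set_cvg_integral => //.
  - by move=> n; apply/measurable_EFinP; exact: measurable_kern.
  - by move=> n s _; rewrite lee_fin.
apply: (@le_trans _ _ (\int[leb]_(s in \bigcup_n A n) (kern s)%:E)%E).
  apply: ge0_subset_integral => //=.
  - by apply: bigcup_measurable => n _; exact: mA.
  - by apply/measurable_EFinP; exact: measurable_kern.
  - by move=> s _; rewrite lee_fin.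
  - move=> s; rewrite /= in_itv/= => /andP[s0 st].
    have ts0 : 0 < tau - s by rewrite subr_gt0.
    exists (Num.truncn (tau / (tau - s))) => //; rewrite /A/= in_itv/= (ltW s0)/=.
    rewrite lerBrDr -lerBrDl ler_pdivrMr// -ler_pdivrMl// mulrC.
    by apply: (le_trans (ltW (truncnS_gt _))); rewrite ler_nat.
rewrite -(cvg_lim _ H)//; apply: lime_le; first by apply/cvg_ex; eexists; exact: H.
apply: nearW => n; set b := tau - tau / n.+2%:R.
have b0 : 0 < b by rewrite subr_gt0.
have dP p s : 0 <= s <= b ->
    is_derive s 1 (fun s => (tau - s) `^ p) (- (p * (tau - s) `^ (p - 1))).
  move=> /andP[_ sb]; have ts0 : 0 < tau - s.
    by rewrite subr_gt0 (le_lt_trans sb)// gtrBl divr_gt0.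
  have H1 : is_derive s 1 (fun s : R => tau - s) (- 1).
    have := is_deriveB (is_derive_cst tau s 1) (is_derive_id s 1).
    by rewrite sub0r.
  have := @is_derive1_comp _ (@powR R ^~ p) (fun s => tau - s) s _ _ (is_derive1_powR p ts0) H1.
  by rewrite mulrN1.
have dF s : 0 <= s <= b ->
    is_derive s 1 (fun s => - (alpha^-1) * (tau - s) `^ alpha) (kern s).
  move=> sb; have := is_deriveZ (- (alpha^-1)) (dP alpha s sb).
  by rewrite /GRing.scale/= mulrNN mulKf ?gt_eqF.
rewrite (@continuous_FTC2 _ kern (fun s => - (alpha^-1) * (tau - s) `^ alpha) 0 b b0).
- rewrite subr0 -EFinB lee_fin !mulNr opprK addrC [tau `^ _ / _]mulrC gerBl.
  by rewrite mulr_ge0 ?powR_ge0// invr_ge0 ltW.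
- exact: (within_derive (dP (alpha - 1))).
- exact: LRcontinuous_derive b0 dF.
- move=> s; rewrite in_itv/= => /andP[s1 s2].
  by rewrite derive1E; have [|_ ->//] := dF s; rewrite !ltW.
Qed.

Lemma ae_imply (P Q : R -> Prop) : (forall s, P s -> Q s) ->
  {ae leb, forall s, P s} -> {ae leb, forall s, Q s}.
Proof.
move=> PQ.
exact: (@filterS _ _ (ae_filter_ringOfSetsType (@lebesgue_measure R)) P Q PQ).
Qed.

(** The bound is asked almost everywhere because the norm in time is an essential supremum. *)
Lemma kernel_dominated (h : R -> R) (C : R) : 0 <= C -> measurable_fun I0 h ->
  {ae leb, forall s, I0 s -> `|h s| <= C * kern s} ->
  leb.-integrable I0 (EFin \o h) /\
  `|\int[leb]_(s in I0) h s| <= C * (tau `^ alpha / alpha).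
Proof.
move=> C0 mh hle.
have mI : measurable (I0 : set (measurableTypeR R)) by exact: measurable_itv.
have H : (\int[leb]_(s in I0) `|(h s)%:E| <= (C * (tau `^ alpha / alpha))%:E)%E.
  apply: (@le_trans _ _ (\int[leb]_(s in I0) (C%:E * (kern s)%:E))%E).
    apply: ae_ge0_le_integral => //.
    - by apply: measurableT_comp => //; exact/measurable_EFinP.
    - by move=> s _; rewrite mule_ge0// lee_fin.
    - by apply: measurable_funeM; apply/measurable_EFinP; exact: measurable_kern.
  rewrite ge0_integralZl//; last 2 first.
  - by apply/measurable_EFinP; exact: measurable_kern.
  - by move=> s _; rewrite lee_fin.
  by rewrite EFinM lee_pmul// ?integral_ge0//;
    [move=> s _; rewrite lee_fin|exact: integral_kernel_le].
have ih : leb.-integrable I0 (EFin \o h).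
  apply/integrableP; split; first exact/measurable_EFinP.
  by apply: (le_lt_trans H); rewrite ltry.
split => //.
have := le_normr_Rintegral mI ih; move=> /le_trans; apply.
rewrite /Rintegral -lee_fin fineK; first exact: H.
rewrite ge0_fin_numE; last by apply: integral_ge0 => s _; rewrite lee_fin.
by apply: (le_lt_trans H); rewrite ltry.
Qed.

Lemma simple_dot z w : simple_L2 Om z -> L2 Om w ->
  (forall s, L2 Om (z s)) /\ measurable_fun setT (fun s => dot (z s) w).
Proof.
move=> [m [A [v [mA hv zE]]]] hw.
have zE' s : z s = fun x => \sum_(i < m) \1_(A i) s * v i x by apply/funext => x.
have hi s i : L2 Om (fun x => \1_(A i) s * v i x) by exact: L2Z.
split; first by move=> s; rewrite zE'; apply: L2_sum.
have -> : (fun s => dot (z s) w) = (fun s => \sum_(i < m) \1_(A i) s * dot (v i) w).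
  apply/funext => s; rewrite zE' dot_suml//.
  by apply: eq_bigr => i _; rewrite dotZl.
apply: measurable_sum => i; apply: measurable_funM => //.
by apply: measurable_indic; exact: mA.
Qed.

(** Strong measurability implies weak measurability: scalar products with simple functions are
    measurable and converge pointwise on the interval. *)
Lemma measurable_dot z w : LinfL2 Om tau z -> L2 Om w ->
  measurable_fun I0 (fun s => dot (z s) w).
Proof.
move=> [hz [zk [hzk cvz]] _] hw.
apply: (measurable_fun_cvg (h := fun k s => dot (zk k s) w)).
- by move=> k; apply: measurable_funTS; have [] := simple_dot (hzk k) hw.
- move=> s hs; apply: cvg_dotl => //.
  + by move=> k; have [] := simple_dot (hzk k) hw.
  + exact: hz.
  + exact: cvz.
Qed.

Lemma LinfL2_bound z (F : R) : (forall s, I0 s -> L2 Om (z s)) ->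
  (LinfL2norm Om tau z <= F%:E)%E ->
  {ae leb, forall s, I0 s -> Num.sqrt (dot (z s) (z s)) <= F}.
Proof.
have oo : leb setT = +oo%E by rewrite -set_itvNyy lebesgue_measure_itv.
(* The norm with exponent [+oo] is the essential supremum when the whole space has positive
   measure. *)
move=> hz; rewrite /LinfL2norm unlock ifT; last first.
  have: (0 < leb setT)%E by rewrite oo.
  exact.
move=> /ess_supP; apply: filterS => s /= + hs.
rewrite /patch mem_set// L2normE; last exact: hz.
by rewrite abse_EFin lee_fin ger0_norm// sqrtr_ge0.
Qed.

Section modes.
Variables (lam : nat -> R) (phi : nat -> euclid R d -> R).
Hypothesis phiB : orthonormal_basis Om phi.

Let hphi n : (1 <= n)%N -> L2 Om (phi n). Proof. by case: phiB => + _ _; apply. Qed.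

Let ml n s : R := mittag_leffler alpha alpha (- lam n ^+ 2 * (tau - s) `^ alpha).

Let M : R := (Gamma alpha)^-1.

Let M_ge0 : 0 <= M. Proof. by rewrite invr_ge0 gamma_ge0. Qed.

Let ml_bounds n s : 0 <= ml n s <= M.
Proof.
rewrite /ml mulNr; apply: mittag_leffler_bounds => //.
by rewrite mulr_ge0 ?sqr_ge0 ?powR_ge0.
Qed.

Let measurable_ml n (D : set R) : measurable_fun D (ml n).
Proof.
apply: measurable_funTS.
have -> : ml n = (fun x => mittag_leffler alpha alpha (- `|x|)) \o
    (fun s => lam n ^+ 2 * (tau - s) `^ alpha).
  apply/funext => s; rewrite /ml /= ger0_norm ?mulNr//.
  by rewrite mulr_ge0 ?sqr_ge0 ?powR_ge0.
apply: measurableT_comp; first exact: measurable_mittag_leffler.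
apply: measurable_funM => //.
apply: (measurableT_comp (measurable_powR _)).
exact: measurable_funB.
Qed.

(** [Psi] is a real-valued integral, so subtracting two of them under one integral sign requires the
    integrability of each integrand. *)
Lemma integrable_Psi z n : (1 <= n)%N -> LinfL2 Om tau z ->
  leb.-integrable I0 (EFin \o (fun s => kern s * ml n s * dot (z s) (phi n))).
Proof.
move=> n1 hz; have [hzs _ hfin] := hz.
pose F := fine (LinfL2norm Om tau z).
have F0 : 0 <= F by rewrite fine_ge0// /LinfL2norm Lnorm_ge0.
have hF : (LinfL2norm Om tau z <= F%:E)%E.
  by rewrite fineK// ge0_fin_numE// /LinfL2norm Lnorm_ge0.
have hae := LinfL2_bound hzs hF.
have mI : measurable (I0 : set (measurableTypeR R)) by exact: measurable_itv.
set C := M * (F * Num.sqrt (dot (phi n) (phi n))).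
have C0 : 0 <= C by rewrite !mulr_ge0 ?sqrtr_ge0.
have mh : measurable_fun I0 (fun s => kern s * ml n s * dot (z s) (phi n)).
  apply: measurable_funM; last by apply: measurable_dot => //; exact: hphi.
  by apply: measurable_funM; [exact: measurable_kern|exact: measurable_ml].
have hle : {ae leb, forall s, I0 s -> `|kern s * ml n s * dot (z s) (phi n)| <= C * kern s}.
  apply: ae_imply hae => s hs Is.
  have /andP[m0 mM] := ml_bounds n s.
  rewrite normrM ger0_norm ?mulr_ge0// [kern s * _]mulrC mulrAC ler_wpM2r// ler_pM//.
  apply: (le_trans (normr_dot_le (hzs _ Is) (hphi n1))).
  by rewrite ler_wpM2r ?sqrtr_ge0// hs.
by have [] := kernel_dominated C0 mh hle.
Qed.

(* Testing against the vector of the differences [D] itself turns the sum over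
   the modes into one integral, whose integrand is a scalar product with
   [f s - g s]. *)
Lemma Psi_diff_le f g (F : R) N : LinfL2 Om tau f -> LinfL2 Om tau g -> 0 <= F ->
  (LinfL2norm Om tau (fun s => f s \- g s)%R <= F%:E)%E ->
  \sum_(n < N) (Psi Om lam phi alpha f n.+1 tau - Psi Om lam phi alpha g n.+1 tau) ^+ 2 <=
  (M * F * (tau `^ alpha / alpha)) ^+ 2.
Proof.
move=> hf hg F0 hF; have [hfs _ _] := hf; have [hgs _ _] := hg.
have mI : measurable (I0 : set (measurableTypeR R)) by exact: measurable_itv.
have hzs s : I0 s -> L2 Om (f s \- g s) by move=> Is; apply: L2B; [exact: hfs|exact: hgs].
pose D n := Psi Om lam phi alpha f n tau - Psi Om lam phi alpha g n tau.
pose S := \sum_(n < N) D n.+1 ^+ 2.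
rewrite -/S.
have S0 : 0 <= S by apply: sumr_ge0 => n _; rewrite sqr_ge0.
pose h n s := kern s * ml n s * dot (f s) (phi n) - kern s * ml n s * dot (g s) (phi n).
have hD n : (1 <= n)%N -> D n = \int[leb]_(s in I0) h n s.
  by move=> n1; rewrite RintegralB//; exact: integrable_Psi.
have ih n : (1 <= n)%N -> leb.-integrable I0 (EFin \o h n).
  move=> n1; have := integrableB mI (integrable_Psi n1 hf) (integrable_Psi n1 hg).
  by apply: eq_integrable => // s _.
pose H s := \sum_(n < N) D n.+1 * h n.+1 s.
have SE : S = \int[leb]_(s in I0) H s.
  have : \sum_(n < N) D n.+1 * (\int[leb]_(s in I0) h n.+1 s) = \int[leb]_(s in I0) H s /\
     leb.-integrable I0 (EFin \o H).
    rewrite /H; elim: N {S S0 H} => [|m [IH1 IH2]].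
      split.
        rewrite big_ord0; under eq_Rintegral do rewrite big_ord0.
        by rewrite Rintegral_cst// mul0r.
      by apply: (eq_integrable mI (cst 0%E)) => [s _|]; [rewrite /= big_ord0|exact: integrable0].
    have iZ : leb.-integrable I0 (EFin \o (fun s => D m.+1 * h m.+1 s)).
      by have := integrableZl mI (D m.+1) (ih m.+1 isT); apply: eq_integrable.
    split.
      rewrite big_ord_recr/= IH1 -RintegralZl//; last exact: ih.
      rewrite -RintegralD//.
      by apply: eq_Rintegral => s _; rewrite big_ord_recr.
    have := integrableD mI IH2 iZ; apply: eq_integrable => // s _ /=.
    by rewrite big_ord_recr.
  move=> [<- _]; apply: eq_bigr => n _; by rewrite -hD// expr2.
have mh n : (1 <= n)%N -> measurable_fun I0 (h n).
  by move=> n1; apply/measurable_EFinP; have /integrableP[] := ih n n1.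
have mH : measurable_fun I0 H.
  apply: measurable_sum => n; apply: measurable_funM => //; exact: mh.
have hae := LinfL2_bound hzs hF.
have C0 : 0 <= M * F * Num.sqrt S by rewrite !mulr_ge0 ?sqrtr_ge0.
have hle : {ae leb, forall s, I0 s -> `|H s| <= M * F * Num.sqrt S * kern s}.
  apply: ae_imply hae => s hs Is.
  (* Cauchy-Schwarz in space now applies; orthonormality and the bound [M] on the Mittag-Leffler
     factors bound the norm of the combination by [M * Num.sqrt S]. *)
  have -> : H s = kern s * dot (lincomb phi (fun n => D n * ml n s) N) (f s \- g s).
    rewrite (dot_lincombl phiB); last exact: hzs.
    rewrite mulr_sumr; apply: eq_bigr => n _; rewrite dotBl; last 3 first.
    - exact: hfs.
    - exact: hgs.
    - exact: hphi.
    by rewrite /h; ring.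
  rewrite normrM (ger0_norm (kern_ge0 s)) mulrC ler_wpM2r//.
  apply: (le_trans (normr_dot_le (L2_lincomb phiB _ _) (hzs _ Is))).
  rewrite mulrAC ler_pM ?sqrtr_ge0 ?hs//.
  rewrite (dot_lincomb phiB) -(ger0_norm M_ge0) -sqrtr_sqr -sqrtrM ?sqr_ge0//.
  rewrite ler_wsqrtr// /S mulr_sumr; apply: ler_sum => n _.
  have /andP[m0 mM] := ml_bounds n.+1 s.
  by rewrite exprMn mulrC ler_wpM2r ?sqr_ge0// lerXn2r ?nnegrE.
have [_] := kernel_dominated C0 mH hle; rewrite -SE (ger0_norm S0) => HS.
have K0 : 0 <= M * F * (tau `^ alpha / alpha).
  by rewrite !mulr_ge0 ?invr_ge0 ?gamma_ge0 ?powR_ge0 ?(ltW alpha0).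
have : Num.sqrt S ^+ 2 <= M * F * (tau `^ alpha / alpha) * Num.sqrt S.
  by rewrite sqr_sqrtr//; apply: (le_trans HS); rewrite le_eqVlt; apply/orP; left; apply/eqP; ring.
(* The inequality for [S] is divided by [Num.sqrt S], hence the case distinction. *)
have [s0|s0] := eqVneq (Num.sqrt S) 0.
  by move=> _; rewrite -(sqr_sqrtr S0) s0 expr0n/= sqr_ge0.
rewrite expr2 ler_pM2r ?lt0r ?s0 ?sqrtr_ge0// => Hs.
by rewrite -(sqr_sqrtr S0) lerXn2r ?nnegrE ?sqrtr_ge0.
Qed.

End modes.
End source_term.

(** * Convergence rate *)

Section rates.
Context {R : realType}.

Lemma powR_exp_ln (a r : R) : 0 < a -> a `^ r = expR (r * ln a).
Proof. by move=> a0; rewrite /powR gt_eqF. Qed.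

(** Removes the dependence on [p] from the final constant: the exponents [2 / (p + 2)] and
    [p / (p + 2)] both lie between 0 and 1. *)
Lemma powR_le1D (a r : R) : 0 < a -> 0 <= r <= 1 -> a `^ r <= 1 + a.
Proof.
move=> a0 /andP[r0 r1]; have [a1|a1] := leP 1 a.
  by apply: (le_trans (ler1_powR a1 r1)); rewrite lerDr.
have : a `^ r <= a `^ 0 by apply: ger_powR => //; rewrite a0 ltW.
by rewrite powRr0 => /le_trans; apply; rewrite lerDl ltW.
Qed.

Variables (c e1 e2 rho delta p : R).
Hypotheses (c0 : 0 < c) (e10 : 0 < e1) (e20 : 0 < e2) (rho0 : 0 < rho)
  (delta0 : 0 < delta) (p0 : 0 < p).

Let X : R := 1 / (c * e1 `^ p * e2 ^+ 2) * (rho / delta).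

Let e1p0 : 0 < e1 `^ p. Proof. exact: powR_gt0. Qed.

Lemma source_ratio_gt0 : 0 < X.
Proof. by rewrite /X mulr_gt0 ?divr_gt0 ?mulr_gt0 ?exprn_gt0. Qed.

Let lnX : ln X = - (ln c + p * ln e1 + 2 * ln e2) + (ln rho - ln delta).
Proof.
have h1 : 0 < c * e1 `^ p by rewrite mulr_gt0.
have h2 : 0 < c * e1 `^ p * e2 ^+ 2 by rewrite mulr_gt0 ?exprn_gt0.
rewrite /X div1r lnM ?posrE ?invr_gt0 ?divr_gt0// lnV ?posrE//.
rewrite lnM ?posrE ?exprn_gt0// lnM ?posrE// ln_powR lnXn//.
by rewrite lnM ?posrE ?invr_gt0// lnV ?posrE// mulr2n; ring.
Qed.

Let p2 : p + 2 != 0. Proof. by rewrite gt_eqF// addr_gt0. Qed.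

(** After taking logarithms, an identity between products of powers becomes one linear in the
    logarithms, which [field] settles. The same holds for [tail_rate]. *)
Lemma head_rate : (X `^ (p + 2)^-1) ^+ 2 * delta =
  c^-1 `^ (2 / (p + 2)) * (e1 ^- 2) `^ (p / (p + 2)) * (e2 ^- 2) `^ (2 / (p + 2)) *
  (rho `^ (2 / (p + 2)) * delta `^ (p / (p + 2))).
Proof.
have sq (e : R) : 0 < e -> ln (e ^- 2) = - (2 * ln e).
  by move=> e0; rewrite lnV ?posrE ?exprn_gt0// lnXn// mulr2n; ring.
rewrite -[X in _ * X = _](lnK delta0).
rewrite !powR_exp_ln ?source_ratio_gt0 ?invr_gt0 ?exprn_gt0// -expRM_natl -!expRD.
congr expR; rewrite lnX !sq// lnV ?posrE//; field.
exact: p2.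
Qed.

Lemma tail_rate : (e1 * X `^ (p + 2)^-1) `^ (- p) * rho =
  c `^ (p / (p + 2)) * (e1 ^- 2) `^ (p / (p + 2)) * (e2 ^+ 2) `^ (p / (p + 2)) *
  (rho `^ (2 / (p + 2)) * delta `^ (p / (p + 2))).
Proof.
have X0 := source_ratio_gt0.
have h : 0 < e1 * X `^ (p + 2)^-1 by rewrite mulr_gt0 ?powR_gt0.
rewrite -[X in _ * X = _](lnK rho0).
rewrite [(e1 * _) `^ _]powR_exp_ln// lnM ?posrE ?powR_gt0// ln_powR.
rewrite !powR_exp_ln ?invr_gt0 ?exprn_gt0// -!expRD.
congr expR; rewrite lnX lnV ?posrE ?exprn_gt0// !lnXn// !mulr2n; field.
exact: p2.
Qed.

(** The first summand is the head error with [lambda_N] replaced by its upper bound, the second the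
    tail error with [lambda_(N+1)] replaced by its lower bound. Both have the same powers of [rho]
    and [delta], and [powR_le1D] makes the constant free of [p]. *)
Lemma rate_bound (K : R) : 0 <= K ->
  K * (e2 * X `^ (p + 2)^-1) ^+ 2 * delta + (e1 * X `^ (p + 2)^-1) `^ (- p) * rho <=
  (K * e2 ^+ 2 * ((1 + c^-1) * (1 + e1 ^- 2) * (1 + e2 ^- 2)) +
     (1 + c) * (1 + e1 ^- 2) * (1 + e2 ^+ 2)) *
  rho `^ (2 / (p + 2)) * delta `^ (p / (p + 2)).
Proof.
move=> K0.
have pp2 : 0 < p + 2 by rewrite addr_gt0.
have q1 : 0 <= 2 / (p + 2) <= 1.
  by rewrite divr_ge0 ?(ltW pp2)//= ler_pdivrMr// mul1r lerDr ltW.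
have q2 : 0 <= p / (p + 2) <= 1.
  by rewrite divr_ge0 ?(ltW pp2) ?(ltW p0)//= ler_pdivrMr// mul1r lerDl.
have -> : K * (e2 * X `^ (p + 2)^-1) ^+ 2 * delta =
  K * e2 ^+ 2 * ((X `^ (p + 2)^-1) ^+ 2 * delta) by ring.
rewrite head_rate tail_rate [leRHS](_ : _ =
  K * e2 ^+ 2 * ((1 + c^-1) * (1 + e1 ^- 2) * (1 + e2 ^- 2) *
    (rho `^ (2 / (p + 2)) * delta `^ (p / (p + 2)))) +
  (1 + c) * (1 + e1 ^- 2) * (1 + e2 ^+ 2) *
    (rho `^ (2 / (p + 2)) * delta `^ (p / (p + 2)))); last by ring.
have r0 : 0 <= rho `^ (2 / (p + 2)) * delta `^ (p / (p + 2)) by rewrite mulr_ge0 ?powR_ge0.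
have b3 (x y z t u v : R) : 0 <= x <= t -> 0 <= y <= u -> 0 <= z <= v -> x * y * z <= t * u * v.
  move=> /andP[x0 xt] /andP[y0 yu] /andP[z0 zv].
  by rewrite ler_pM ?mulr_ge0// ler_pM.
have bnd (a r : R) : 0 < a -> 0 <= r <= 1 -> 0 <= a `^ r <= 1 + a.
  by move=> a0 hr; rewrite powR_ge0 powR_le1D.
have e12 : 0 < e1 ^- 2 by rewrite invr_gt0 exprn_gt0.
have e22 : 0 < e2 ^- 2 by rewrite invr_gt0 exprn_gt0.
have e22' : 0 < e2 ^+ 2 by rewrite exprn_gt0.
have ci : 0 < c^-1 by rewrite invr_gt0.
apply: lerD; last by rewrite ler_wpM2r//; apply: b3; exact: bnd.
rewrite (ler_wpM2l (mulr_ge0 K0 (ltW e22')))//.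
by rewrite ler_wpM2r//; apply: b3; exact: bnd.
Qed.

End rates.

(** * Splitting of the regularization error into head and tail *)

Definition inv_symbol_const (R : realType) (alpha tau C1 l : R) : R :=
  Gamma (1 - alpha) * (1 + tau `^ alpha * l ^+ 2) / (C1 * l ^+ 2).

(** The amplification of [delta ^ 2] in [Upsilon_diff_le]: 2 comes from squaring a difference, 1
    from [h], and the square from [f] via [Psi_diff_le] with the bound [l ^ 2 * delta]. *)
Definition data_const (R : realType) (alpha tau l : R) : R :=
  2 * (1 + ((Gamma alpha)^-1 * l ^+ 2 * (tau `^ alpha / alpha)) ^+ 2).

Section error_estimate.
Context {R : realType} {d : nat} {Om : set (euclid R d)}.
Variables (alpha tau C1 : R).
Hypotheses (alpha01 : 0 < alpha < 1) (tau0 : 0 < tau) (C10 : 0 < C1).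
Hypothesis hML : forall x : R, x <= 0 ->
  C1 / Gamma (1 - alpha) * (1 / (1 - x)) <= mittag_leffler alpha 1 x.
Variables (lam : nat -> R) (phi : nat -> euclid R d -> R).
Hypotheses (phiB : orthonormal_basis Om phi) (lam1 : 0 < lam 1%N)
  (lamS : forall n, (1 <= n)%N -> lam n <= lam n.+1).
Notation dot := (L2dot Om).
Notation kappa := (inv_symbol_const alpha tau C1 (lam 1%N)).
Notation eta := (data_const alpha tau (lam 1%N)).

Lemma lam_le m n : (1 <= m <= n)%N -> lam m <= lam n.
Proof.
move=> /andP[m1 /subnKC <-]; elim: (n - m)%N => [|k IH]; first by rewrite addn0.
by rewrite addnS (le_trans IH)// lamS// (leq_trans m1)// leq_addr.
Qed.

Lemma lam_gt0 n : (1 <= n)%N -> 0 < lam n.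
Proof. by move=> n1; apply: (lt_le_trans lam1); apply: lam_le; rewrite n1. Qed.

Let G0 : 0 < Gamma (1 - alpha).
Proof. by case/andP: alpha01 => _ ?; rewrite gamma_gt0// subr_gt0. Qed.

Lemma inv_symbol_const_gt0 : 0 < kappa.
Proof.
rewrite /inv_symbol_const divr_gt0 ?mulr_gt0 ?exprn_gt0//.
by rewrite ltr_wpDr// mulr_ge0 ?powR_ge0 ?sqr_ge0.
Qed.

(** Since [lambda_n >= lambda_1], one has [1 + lambda_n^2 tau^alpha <= lambda_n^2 (1 / lambda_1^2 +
    tau^alpha)]; this yields [kappa], which is [C18] without the factor [Num.sqrt 2]. *)
Lemma T_symbol_bound n : (1 <= n)%N ->
  0 < T_symbol lam alpha tau n /\
  (T_symbol lam alpha tau n)^-1 <= kappa * lam n ^+ 2.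
Proof.
move=> n1; have ln0 := lam_gt0 n1.
have x0 : 0 <= lam n ^+ 2 * tau `^ alpha by rewrite mulr_ge0 ?sqr_ge0 ?powR_ge0.
have := hML (x := - lam n ^+ 2 * tau `^ alpha).
rewrite mulNr oppr_le0 opprK -mulNr -/(T_symbol lam alpha tau n) => /(_ x0) H.
have y0 : 0 < 1 + lam n ^+ 2 * tau `^ alpha by rewrite ltr_wpDr.
have b0 : 0 < C1 / Gamma (1 - alpha) * (1 / (1 + lam n ^+ 2 * tau `^ alpha)).
  by rewrite mulr_gt0 ?divr_gt0.
have T0 := lt_le_trans b0 H; split => //.
apply: (@le_trans _ _ (C1 / Gamma (1 - alpha) * (1 / (1 + lam n ^+ 2 * tau `^ alpha)))^-1).
  by rewrite lef_pV2 ?posrE.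
rewrite div1r !invfM !invrK /inv_symbol_const.
have l10 : 0 < lam 1%N ^+ 2 by rewrite exprn_gt0.
have -> : Gamma (1 - alpha) * (1 + tau `^ alpha * lam 1%N ^+ 2) / (C1 * lam 1%N ^+ 2) *
   lam n ^+ 2 = C1^-1 * Gamma (1 - alpha) *
     (lam n ^+ 2 / lam 1%N ^+ 2 + lam n ^+ 2 * tau `^ alpha).
  by field; rewrite !gt_eqF.
rewrite ler_wpM2l ?mulr_ge0 ?invr_ge0 ?(ltW G0) ?(ltW C10)// lerD2r.
rewrite ler_pdivlMr// mul1r lerXn2r ?nnegrE ?(ltW lam1) ?(ltW ln0)//.
by apply: lam_le; rewrite n1.
Qed.

Lemma source_set_partial (rho p : R) g M : 0 < rho -> 0 < p ->
  source_set Om lam phi rho p g ->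
  \sum_(n < M) lam n.+1 `^ (2 * p) * dot g (phi n.+1) ^+ 2 <= rho ^+ 2.
Proof.
move=> rho0 p0 [_]; rewrite /Hp_norm.
set u := fun n => (lam n `^ (2 * p) * `|dot g (phi n)| ^+ 2)%:E.
have u0 n : (0 <= u n)%E by rewrite lee_fin mulr_ge0 ?powR_ge0 ?sqr_ge0.
have hS : (\sum_(1 <= i < M.+1) u i <= \sum_(1 <= n <oo) u n)%E.
  by apply: nneseries_lim_ge.
have S0 : (0 <= \sum_(1 <= n <oo) u n)%E by apply: nneseries_ge0.
rewrite -[X in (X `^ _)%E]/(\sum_(1 <= n <oo) u n)%E.
(* A divergent series is excluded: its square root would be [+oo], above [rho]. *)
move: S0 hS; case: (\sum_(1 <= n <oo) u n)%E => [r||//]; last first.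
  by move=> _ _; rewrite poweRyr// gt_eqF.
rewrite lee_fin => r0; rewrite /u sumEFin lee_fin big_add1 big_mkord => hS.
rewrite poweR_EFin lee_fin powR12_sqrt// => hr.
apply: (le_trans _ (le_trans hS _)).
  rewrite le_eqVlt; apply/orP; left; apply/eqP.
  by apply: eq_bigr => n _; rewrite real_normK ?num_real.
by rewrite -(sqr_sqrtr r0) lerXn2r ?nnegrE ?sqrtr_ge0// ltW.
Qed.

(** Keeps the first term of the series; it turns the weight [theta] in the data error into a bound
    of the norm of [f - fdelta] by [lambda_1^2 delta]. *)
Lemma theta_ge : ((lam 1%N ^- 4)%:E <= theta lam)%E.
Proof.
have H : (\sum_(1 <= i < 2) (lam i ^- 4)%:E <= \sum_(1 <= n <oo) (lam n ^- 4)%:E)%E.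
  apply: nneseries_lim_ge => n n1 _; rewrite lee_fin invr_ge0 exprn_ge0// ltW//.
  exact: lam_gt0.
by rewrite big_nat1 in H.
Qed.

Lemma Upsilon_diff_le (delta : R) h hdelta f fdelta N : 0 < delta ->
  L2 Om h -> L2 Om hdelta -> LinfL2 Om tau f -> LinfL2 Om tau fdelta ->
  (L2norm Om (h \- hdelta)%R ^+ 2 +
     theta lam * LinfL2norm Om tau (fun s => (f s \- fdelta s)%R) ^+ 2
   <= (delta ^+ 2)%:E)%E ->
  \sum_(n < N) (Upsilon_coef Om lam phi alpha tau h f n.+1 -
                Upsilon_coef Om lam phi alpha tau hdelta fdelta n.+1) ^+ 2 <=
  eta * delta ^+ 2.
Proof.
move=> delta0 hh hhd hf hfd.
have hB := L2B hh hhd.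
set Fe := LinfL2norm _ _ _.
have Fe0 : (0 <= Fe)%E by rewrite /Fe /LinfL2norm Lnorm_ge0.
have l4 : 0 < lam 1%N ^- 4 by rewrite invr_gt0 exprn_gt0.
have th0 := theta_ge.
rewrite L2normE// -EFin_expe sqr_sqrtr ?dot_ge0// => Hd.
have sq0 : (0 <= Fe ^+ 2)%E by exact: expe_ge0.
have thF0 : (0 <= theta lam * Fe ^+ 2)%E.
  by rewrite mule_ge0// (le_trans _ th0)// lee_fin ltW.
have Hh : dot (h \- hdelta) (h \- hdelta) <= delta ^+ 2.
  by rewrite -lee_fin (le_trans _ Hd)// leeDl.
have HF : ((lam 1%N ^- 4)%:E * Fe ^+ 2 <= (delta ^+ 2)%:E)%E.
  apply: (le_trans (lee_wpmul2r sq0 th0)); apply: (le_trans _ Hd).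
  by rewrite leeDr// lee_fin dot_ge0.
(* The norm of [f - fdelta] is finite because an infinite one would make the left side of [HF]
   infinite. *)
have [F F0 FE] : exists2 F : R, 0 <= F & Fe = F%:E.
  move: Fe0 HF; case: (Fe) => [F||//]; first by rewrite lee_fin => ? _; exists F.
  by rewrite -[(+oo ^+ 2)%E]/(+oo * +oo)%E mulyy mulry gtr0_sg// mul1e.
have Fle : F <= lam 1%N ^+ 2 * delta.
  move: HF; rewrite FE -EFin_expe -EFinM lee_fin mulrC ler_pdivrMr ?exprn_gt0// => HF.
  have : F ^+ 2 <= (lam 1%N ^+ 2 * delta) ^+ 2.
    by apply: (le_trans HF); rewrite exprMn -exprM mulrC.
  by rewrite ler_pXn2r// nnegrE ?mulr_ge0 ?sqr_ge0// ltW.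
have HFe : (Fe <= (lam 1%N ^+ 2 * delta)%:E)%E by rewrite FE lee_fin.
have B0 : 0 <= lam 1%N ^+ 2 * delta by apply: le_trans Fle.
have HP := @Psi_diff_le _ _ _ _ _ alpha01 tau0 lam phi phiB f fdelta _ N hf hfd B0 HFe.
have HB := @bessel _ _ _ phi phiB _ N hB.
apply: (@le_trans _ _ (2 * \sum_(n < N) dot (h \- hdelta) (phi n.+1) ^+ 2 +
  2 * \sum_(n < N) (Psi Om lam phi alpha f n.+1 tau - Psi Om lam phi alpha fdelta n.+1 tau) ^+ 2)).
  rewrite !mulr_sumr -big_split/=; apply: ler_sum => n _.
  have [H1 _ _] := phiB.
  rewrite dotBl//; last exact: H1.
  rewrite /Upsilon_coef; set x1 := dot _ _; set x2 := dot _ _; set y1 := Psi _ _ _ _ _ _ _.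
  set y2 := Psi _ _ _ _ _ _ _.
  rewrite -subr_ge0 (_ : _ - _ = ((x1 - x2) + (y1 - y2)) ^+ 2) ?sqr_ge0//.
  ring.
rewrite /data_const; move: HP HB Hh; set a := \sum_(n < N) _; set b := \sum_(n < N) _.
set q := dot _ _; move=> HP HB Hh.
have E : ((Gamma alpha)^-1 * (lam 1%N ^+ 2 * delta) * (tau `^ alpha / alpha)) ^+ 2 =
  ((Gamma alpha)^-1 * lam 1%N ^+ 2 * (tau `^ alpha / alpha)) ^+ 2 * delta ^+ 2.
  by rewrite -exprMn; congr (_ ^+ _); ring.
rewrite E in HP; set k := ((Gamma alpha)^-1 * lam 1%N ^+ 2 * _) ^+ 2 in HP *.
lra.
Qed.

Lemma error_split (delta rho p : R) h hdelta g U f fdelta N : 0 < delta ->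
  L2 Om h -> L2 Om hdelta -> LinfL2 Om tau f -> LinfL2 Om tau fdelta ->
  (L2norm Om (h \- hdelta)%R ^+ 2 +
     theta lam * LinfL2norm Om tau (fun s => (f s \- fdelta s)%R) ^+ 2
   <= (delta ^+ 2)%:E)%E ->
  L2 Om g -> is_Upsilon Om lam phi alpha tau h f U ->
  is_T Om lam phi alpha tau g U -> 0 < rho -> 0 < p ->
  source_set Om lam phi rho p g -> (1 <= N)%N ->
  (L2norm Om (g \- truncated_solution Om lam phi alpha tau hdelta fdelta N)%R <=
   (kappa * Num.sqrt eta * lam N ^+ 2 * delta +
    lam N.+1 `^ (- p) * rho)%:E)%E.
Proof.
move=> delta0 hh hhd hf hfd Hd hg HU HT rho0 p0 Hs N1.
set err := (g \- _)%R.
pose T n := T_symbol lam alpha tau n.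
pose ups n := Upsilon_coef Om lam phi alpha tau h f n.
pose upsd n := Upsilon_coef Om lam phi alpha tau hdelta fdelta n.
have htr : L2 Om (truncated_solution Om lam phi alpha tau hdelta fdelta N).
  exact: L2_lincomb.
have herr : L2 Om err by exact: L2B.
have [hphi _ _] := phiB.
have gE n : T n.+1 * dot g (phi n.+1) = ups n.+1.
  by have := L2sum_coef phiB n HU; rewrite (L2sum_coef phiB n HT).
(* Indices are shifted by one: [n < N] stands for the modes 1 to [N] kept by the truncation. *)
have errE n : dot err (phi n.+1) =
    if (n < N)%N then (ups n.+1 - upsd n.+1) / T n.+1 else dot g (phi n.+1).
  rewrite dotBl//; last exact: hphi.
  rewrite /truncated_solution (dot_lincomb_phi phiB); case: ifP => _; last by rewrite subr0.
  have [T0 _] := T_symbol_bound (ltn0Sn n).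
  have -> : dot g (phi n.+1) = ups n.+1 / T n.+1.
    by rewrite -gE; field; rewrite gt_eqF.
  by rewrite -mulrBl.
have c0 := inv_symbol_const_gt0.
have dc0 : 0 <= eta by rewrite mulr_ge0// addr_ge0// sqr_ge0.
set a := kappa * Num.sqrt eta * lam N ^+ 2 * delta.
set b := lam N.+1 `^ (- p) * rho.
have a0 : 0 <= a.
  exact: mulr_ge0 (mulr_ge0 (mulr_ge0 (ltW c0) (sqrtr_ge0 _)) (sqr_ge0 _)) (ltW delta0).
have b0 : 0 <= b by rewrite mulr_ge0 ?powR_ge0 ?(ltW rho0).
have head : \sum_(n < N) ((ups n.+1 - upsd n.+1) / T n.+1) ^+ 2 <= a ^+ 2.
  have H := Upsilon_diff_le N delta0 hh hhd hf hfd Hd.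
  apply: (@le_trans _ _ (\sum_(n < N) (kappa * lam N ^+ 2) ^+ 2 *
      (ups n.+1 - upsd n.+1) ^+ 2)).
    apply: ler_sum => n _; rewrite exprMn mulrC ler_wpM2r ?sqr_ge0//.
    have [T0 Tle] := T_symbol_bound (ltn0Sn n).
    have k0 := mulr_ge0 (ltW c0) (sqr_ge0 (lam N)).
    rewrite lerXn2r ?nnegrE ?invr_ge0 ?(ltW T0) ?k0//.
    apply: (le_trans Tle); rewrite ler_wpM2l ?(ltW c0)//.
    rewrite lerXn2r ?nnegrE ?(ltW (lam_gt0 _))//.
    by apply: lam_le; rewrite /= ltn_ord.
  rewrite -mulr_sumr; apply: (@le_trans _ _ ((kappa * lam N ^+ 2) ^+ 2 * (eta * delta ^+ 2))).
    by rewrite ler_wpM2l ?sqr_ge0.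
  rewrite le_eqVlt; apply/orP; left; apply/eqP.
  by rewrite -{1}(sqr_sqrtr dc0) /a; ring.
(* For [n >= N] the weight [lambda_(n+1)^(2p)] is at least [lambda_(N+1)^(2p)]. The kept modes are
   padded with 0 so that head and tail add up termwise. *)
have tail M : \sum_(n < M) (if (n < N)%N then 0 else dot g (phi n.+1) ^+ 2) <= b ^+ 2.
  have H := source_set_partial M rho0 p0 Hs.
  have lN := lam_gt0 (ltn0Sn N).
  apply: (@le_trans _ _ ((lam N.+1 `^ (- p)) ^+ 2 *
      \sum_(n < M) lam n.+1 `^ (2 * p) * dot g (phi n.+1) ^+ 2)); last first.
    by rewrite /b exprMn ler_wpM2l ?sqr_ge0.
  rewrite mulr_sumr; apply: ler_sum => n _; case: ifPn => [_|].
    exact: mulr_ge0 (sqr_ge0 _) (mulr_ge0 (powR_ge0 _ _) (sqr_ge0 _)).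
  rewrite -leqNgt => nN; rewrite mulrA ler_peMl ?sqr_ge0//.
  have -> : 2 * p = p * 2%:R by rewrite mulrC.
  rewrite powRrM powR_mulrn ?powR_ge0// -exprMn exprn_ege1//.
  rewrite powRN mulrC ler_pdivlMr ?powR_gt0// mul1r.
  have ln := lam_gt0 (ltn0Sn n).
  apply: (ge0_ler_powR (ltW p0)); rewrite ?nnegrE ?(ltW lN) ?(ltW ln)//.
  by apply: lam_le; rewrite /= ltnS.
rewrite L2normE// lee_fin -(@ger0_norm _ (a + b)) ?addr_ge0// -sqrtr_sqr.
rewrite ler_wsqrtr//; apply: (@le_trans _ _ (a ^+ 2 + b ^+ 2)); last first.
  rewrite -subr_ge0 (_ : _ - _ = 2 * (a * b)); last by ring.
  exact: mulr_ge0 (ler0n _ 2) (mulr_ge0 a0 b0).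
apply: (dot_le_coefs phiB herr) => M.
have le_head : \sum_(n < M) (if (n < N)%N then ((ups n.+1 - upsd n.+1) / T n.+1) ^+ 2 else 0)
    <= \sum_(n < N) ((ups n.+1 - upsd n.+1) / T n.+1) ^+ 2.
  pose F (n : nat) : R := if (n < N)%N then ((ups n.+1 - upsd n.+1) / T n.+1) ^+ 2 else 0.
  have F0 n : 0 <= F n by rewrite /F; case: ifP => // _; exact: sqr_ge0.
  have -> : \sum_(n < N) ((ups n.+1 - upsd n.+1) / T n.+1) ^+ 2 = \sum_(n < N) F n.
    by apply: eq_bigr => n _; rewrite /F ltn_ord.
  rewrite -/(\sum_(n < M) F n) -!(big_mkord xpredT F).
  have [MN|NM] := leqP M N.
    by rewrite (big_cat_nat (n := M) (p := N))//= lerDl sumr_ge0.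
  rewrite (big_cat_nat (n := N) (p := M) (leq0n _) (ltnW NM))//= gerDl.
  rewrite big_nat_cond big1// => n /andP[/andP[Nn _] _].
  by rewrite /F ltnNge Nn.
apply: (le_trans _ (lerD (le_trans le_head head) (tail M))).
rewrite -big_split/=; apply: ler_sum => n _; rewrite errE.
by case: ifP => _; rewrite ?addr0 ?add0r.
Qed.

End error_estimate.

(** * Balancing head and tail by the choice of the truncation level *)

Unset Implicit Arguments.

Theorem theorem5p4 (R : realType) (alpha tau lam1 C1 e1 e2 : R)
    (halpha : 0 < alpha < 1) (htau : 0 < tau) (hlam1 : 0 < lam1)
    (hC1 : 0 < C1)
    (hML : forall x : R, x <= 0 ->
       C1 / Gamma (1 - alpha) * (1 / (1 - x)) <= mittag_leffler alpha 1 x)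
    (he1 : 0 < e1) (he2 : 0 < e2) :
  exists C19 : R, 0 < C19 /\
  forall (d : nat) (Om : set (euclid R d))
    (lam : nat -> R) (phi : nat -> euclid R d -> R)
    (delta rho p : R) (h hdelta g U : euclid R d -> R)
    (f fdelta : R -> euclid R d -> R),
  (1 <= d <= 7)%N ->
  bounded_smooth_domain Om ->
  dirichlet_spectrum Om lam phi ->
  lam 1%N = lam1 ->
  (forall n, (1 <= n)%N ->
     e1 * n%:R `^ (2 / d%:R) <= lam n <= e2 * n%:R `^ (2 / d%:R)) ->
  0 < delta ->
  L2 Om h -> L2 Om hdelta -> LinfL2 Om tau f -> LinfL2 Om tau fdelta ->
  (L2norm Om (h \- hdelta)%R ^+ 2 +
     theta lam * LinfL2norm Om tau (fun s => (f s \- fdelta s)%R) ^+ 2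
   <= (delta ^+ 2)%:E)%E ->
  L2 Om g ->
  is_Upsilon Om lam phi alpha tau h f U ->
  is_T Om lam phi alpha tau g U ->
  0 < rho -> 0 < p ->
  source_set Om lam phi rho p g ->
  let N := N_delta d e1 e2 (C18 alpha tau lam1 C1) p rho delta in
  (1 <= N)%N ->
  (L2norm Om (g \- truncated_solution Om lam phi alpha tau hdelta fdelta N)%R
   <= (C19 * rho `^ (2 / (p + 2)) * delta `^ (p / (p + 2)))%:E)%E.
Proof.
have [a0 a1] := andP halpha.
have G0 : 0 < Gamma (1 - alpha) by rewrite gamma_gt0 ?subr_gt0.
set kappa := inv_symbol_const alpha tau C1 lam1; set eta := data_const alpha tau lam1.
set c := C18 alpha tau lam1 C1.
have l20 : 0 < lam1 ^+ 2 by rewrite exprn_gt0.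
have kappa0 : 0 < kappa.
  rewrite /kappa /inv_symbol_const divr_gt0 ?(mulr_gt0 C1)//.
    by rewrite mulr_gt0// ltr_wpDr// mulr_ge0 ?powR_ge0 ?(ltW l20).
  exact: mulr_gt0.
have c0 : 0 < c by rewrite mulr_gt0 ?sqrtr_gt0.
pose K := kappa * Num.sqrt eta.
have K0 : 0 <= K by rewrite mulr_ge0 ?sqrtr_ge0 ?(ltW kappa0).
(* The constant of [rate_bound]; [c] and [K] are built from [alpha], [tau], [lam1] and [C1] only. *)
exists (K * e2 ^+ 2 * ((1 + c^-1) * (1 + e1 ^- 2) * (1 + e2 ^- 2)) +
     (1 + c) * (1 + e1 ^- 2) * (1 + e2 ^+ 2)).
have p1 (x : R) : 0 < x -> 0 < 1 + x by move=> x0; rewrite addr_gt0.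
have e12 : 0 < e1 ^- 2 by rewrite invr_gt0 exprn_gt0.
have e22 : 0 < e2 ^- 2 by rewrite invr_gt0 exprn_gt0.
have e22' : 0 < e2 ^+ 2 by rewrite exprn_gt0.
have ci : 0 < c^-1 by rewrite invr_gt0.
split.
  apply: ltr_wpDl; last by rewrite !mulr_gt0 ?p1.
  apply: mulr_ge0; first exact: mulr_ge0 K0 (ltW e22').
  by rewrite ltW// !mulr_gt0 ?p1.
move=> d Om lam phi delta rho p h hdelta g U f fdelta /andP[d1 _] _.
move=> [[_ _ lamS _] _ phiB] lamE lam_itv delta0 hh hhd hf hfd Hd hg HU HT rho0 p0 Hs N N1.
have lam10 : 0 < lam 1%N by rewrite lamE.
have := error_split halpha htau hC1 hML phiB lam10 lamS
  delta0 hh hhd hf hfd Hd hg HU HT rho0 p0 Hs N1.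
rewrite lamE -/kappa -/eta -/K => /le_trans; apply; rewrite lee_fin.
pose X := 1 / (c * e1 `^ p * e2 ^+ 2) * (rho / delta).
have X0 : 0 < X by exact: source_ratio_gt0.
(* [N] is the integer part of [X ^ (d / (2p + 4))], whose power [2 / d] is [Y]. So
   [N ^ (2 / d) <= Y <= (N + 1) ^ (2 / d)], and the eigenvalue asymptotics compare [lambda_N] and
   [lambda_(N+1)] with [Y]. *)
pose Y := X `^ (p + 2)^-1.
have d0 : d%:R != 0 :> R by rewrite pnatr_eq0 -lt0n.
have dd0 : 0 <= 2 / d%:R :> R by rewrite divr_ge0.
have YE : Y = (X `^ (d%:R / (2 * p + 4))) `^ (2 / d%:R).
  rewrite -powRrM; congr (_ `^ _); field.
  by rewrite d0/= !gt_eqF ?addr_gt0 ?mulr_gt0.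
have /andP[NX XN] := truncn_itv (powR_ge0 X (d%:R / (2 * p + 4))).
have lamN : 0 <= lam N <= e2 * Y.
  have /andP[h1 h2] := lam_itv N N1; apply/andP; split.
    by apply: le_trans h1; rewrite mulr_ge0 ?powR_ge0 ?(ltW he1).
  apply: (le_trans h2); rewrite ler_wpM2l ?(ltW he2)// YE.
  by apply: ge0_ler_powR => //; rewrite nnegrE ?powR_ge0.
have lamN1 : 0 < e1 * Y <= lam N.+1.
  have /andP[h1 h2] := lam_itv N.+1 (ltn0Sn N); apply/andP; split.
    by rewrite mulr_gt0 ?powR_gt0.
  apply: (le_trans _ h1); rewrite ler_wpM2l ?(ltW he1)// YE.
  by apply: ge0_ler_powR => //; rewrite ?nnegrE ?powR_ge0 ?(ltW XN).
apply: (le_trans _ (rate_bound c0 he1 he2 rho0 delta0 p0 K0)); rewrite -/X -/Y.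
apply: lerD.
  have /andP[h1 h2] := lamN.
  rewrite ler_wpM2r ?(ltW delta0)// ler_wpM2l// lerXn2r ?nnegrE//.
  exact: le_trans h2.
have /andP[h1 h2] := lamN1.
rewrite ler_wpM2r ?(ltW rho0)// !powRN lef_pV2 ?posrE ?powR_gt0 ?(lt_le_trans h1)//.
by apply: (ge0_ler_powR (ltW p0)); rewrite ?nnegrE ?(ltW h1) ?(ltW (lt_le_trans h1 h2)).
Qed.
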